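(* Consider a radiation source moving in $\mathbb{R}^2$ on the linear trajectory $$x(t)=x_o^*+s^*(t-t_o)\sin\theta^*,\qquad y(t)=y_o^*+s^*(t-t_o)\cos\theta^*,$$ with unknown parameters $x_o^*,y_o^*\in\mathbb{R}$, $\theta^*\in[0,2\pi)$, constant speed $s^*>0$, and known reference time $t_o$. Suppose the source triggers $n=3$ binary proximity sensors located at points $(x_j,y_j)$, $j\in\{1,2,3\}$, whose locations are independent and identically distributed in $\mathbb{R}^2$ (with a distribution absolutely continuous with respect to Lebesgue measure), and suppose the noise-free time stamps $t_{j1}^*,t_{j2}^*$, $j\in\{1,2,3\}$ (defined in the context) are available, while the source intensity $\lambda_s^*$ is unknown. Then, with probability one, the linear trajectory (i.e. the parameters $\theta^*,s^*,x_o^*,y_o^*$) is uniquely determined by the three sensor locations $(x_j,y_j)$ and the time stamps $\{t_{j1}^*,t_{j2}^*\}$, $j\in\{1,2,3\}$.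
   Context: Sensors and the source are modeled as points. The distance from sensor $j$ to the source at time $t$ is $d_j(t)=\sqrt{(x(t)-x_j)^2+(y(t)-y_j)^2}$. The noise-free expected received photon rate at sensor $j$ is $z_j(t)=\lambda_s^*e^{-\alpha_s d_j(t)}/d_j(t)^2+\lambda_b$, where $\lambda_s^*>0$ (photon count per second at unit distance with no shielding) is unknown, $\alpha_s\ge 0$ is a shielding coefficient, $\lambda_b$ is the background rate, and $\lambda_T>\lambda_b$ is a threshold fixed a priori. The time stamps recorded by sensor $j$ are $t_{j1}^*$, the smallest $t$, and $t_{j2}^*$, the largest $t$, such that $\int_{t-1/2}^{t+1/2}\frac{e^{-\alpha_s d_j(\tau)}}{d_j(\tau)^2}\,d\tau\ \ge\ \frac{\lambda_T-\lambda_b}{\lambda_s^*}$ (entry into and exit from the sensing range). Standing assumptions: the sensor locations are distinct, i.i.d., with zero mean in each coordinate; the source moves with constant speed; and the noise-free received photon count at each sensor is unimodal in time. *)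

(* Defs.v *)
From HB Require Import structures.
From mathcomp Require Import all_boot all_order all_algebra.
From mathcomp Require Import all_classical all_reals all_analysis.
Set Implicit Arguments. Unset Strict Implicit. Unset Printing Implicit Defensive.
Import Order.TTheory GRing.Theory Num.Theory.
Import numFieldNormedType.Exports.
Local Open Scope classical_set_scope.
Local Open Scope ring_scope.

Section radiation.
Variable R : realType.

Definition traj (xo yo th s t0 t : R) : R * R :=
  (xo + s * (t - t0) * sin th, yo + s * (t - t0) * cos th).

Definition dist2 (p q : R * R) : R :=
  Num.sqrt ((p.1 - q.1) ^+ 2 + (p.2 - q.2) ^+ 2).

(* Window integral  \int_{t-1/2}^{t+1/2} e^{-alpha d_j(tau)} / d_j(tau)^2 dtau,
   as a Lebesgue integral of a nonnegative function in the extended reals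
   (it is +oo when the trajectory passes through the sensor). *)
Definition window_int (alpha xo yo th s t0 : R) (sj : R * R) (t : R) : \bar R :=
  let a := t - 2^-1 in let b := t + 2^-1 in
  let f := fun tau : R => expR (- alpha * dist2 (traj xo yo th s t0 tau) sj)
       / (dist2 (traj xo yo th s t0 tau) sj) ^+ 2 in
  (\int[@lebesgue_measure R]_(tau in `[a, b]) (f tau)%:E)%E.

Definition in_range (alpha lamb lamT lams xo yo th s t0 : R) (sj : R * R) : set R :=
  [set t | (((lamT - lamb) / lams)%:E <= window_int alpha xo yo th s t0 sj t)%E].

Definition is_min_of (A : set R) (m : R) : Prop := A m /\ forall t, A t -> m <= t.
Definition is_max_of (A : set R) (m : R) : Prop := A m /\ forall t, A t -> t <= m.

Definition time_stamps (alpha lamb lamT lams xo yo th s t0 : R) (sj : R * R)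
    (t1 t2 : R) : Prop :=
  is_min_of (in_range alpha lamb lamT lams xo yo th s t0 sj) t1 /\
  is_max_of (in_range alpha lamb lamT lams xo yo th s t0 sj) t2.

Definition photon_count (alpha lamb lams xo yo th s t0 : R) (sj : R * R) (t : R)
    : \bar R :=
  (lams%:E * window_int alpha xo yo th s t0 sj t + lamb%:E)%E.

Definition unimodal (f : R -> \bar R) : Prop :=
  exists m : R,
    (forall a b, a <= b -> b <= m -> (f a <= f b)%E) /\
    (forall a b, m <= a -> a <= b -> (f b <= f a)%E).

End radiation.

Section sensors.
Local Open Scope ereal_scope.
Context {R : realType} {d : measure_display} {Omega : measurableType d}.

Definition mutually_independent3 (P : probability Omega R) (Z : 'I_3 -> Omega -> R * R)
  : Prop :=
  forall B : 'I_3 -> set (R * R), (forall j, measurable (B j)) ->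
    P (\bigcap_(j in [set: 'I_3]) (Z j @^-1` B j)) = \prod_(j < 3) P (Z j @^-1` B j).

Definition identically_distributed3 (P : probability Omega R)
    (Z : 'I_3 -> Omega -> R * R) : Prop :=
  forall (j : 'I_3) (B : set (R * R)), measurable B ->
    P (Z j @^-1` B) = P (Z ord0 @^-1` B).

Definition abs_cont_lebesgue2 (P : probability Omega R) (Zj : Omega -> R * R) : Prop :=
  forall B : set (R * R), measurable B ->
    ((@lebesgue_measure R) \x (@lebesgue_measure R)) B = 0 -> P (Zj @^-1` B) = 0.

End sensors.

(* Main.v *)
(* In the frame of sensor j, let m be the time of closest approach and p the signed distance from the
   trajectory: the window integral at time t is F p (t - m), where F is even in both arguments and
   decreasing away from 0.  Hence t1 + t2 = 2 m.  As m is affine in the sensor position, three non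
   collinear sensors determine (sin th, cos th) / s, so th and s.  Another consistent trajectory can
   only differ by a translation d orthogonal to the motion; if h = (t2 - t1) / 2 and c, c' are the two
   normalised thresholds, then F p h = c and F (p - d) h = c' for each sensor.  When p1 <> p2, the
   equation F (p1 - d) h1 = F (p2 - d) h2 has countably many solutions d, since F is analytic.  For
   fixed d <> 0 and c', the possible values of p3 are countable: the level curves of F are analytic
   graphs over bounded intervals, and such a curve shares no arc with a proper translate of another one.
   Since p3 has no atoms and is independent of (p1, p2), almost surely d = 0. *)

Require Import Defs.
From HB Require Import structures.
From mathcomp Require Import all_boot all_order all_algebra.
From mathcomp Require Import all_classical all_reals all_analysis.
From mathcomp Require Import measurable_realfun.
From mathcomp Require Import ring lra.
Set Implicit Arguments. Unset Strict Implicit. Unset Printing Implicit Defensive.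
Import Order.TTheory GRing.Theory Num.Theory.
Import numFieldNormedType.Exports.
Local Open Scope classical_set_scope.
Local Open Scope ring_scope.

(** * Convergent power series *)

(** Three difficulties shape the proof. The unknown intensity makes [c'] a free parameter: two
    sensors only eliminate it, which leaves countably many [d], and the third one excludes these.
    Next, [F] is a Lebesgue integral, infinite where the source passes through the sensor within the
    window, and it must be shown analytic, as must the curves that it defines implicitly.
    Analyticity is therefore stated through explicit bounds on real power series. Such bounds
    survive pointwise limits, so integrals are treated as limits of Riemann sums, and inverses,
    square roots and implicit functions as limits of Picard iterations. Finally, [d] and [c'] range
    over uncountable sets, so the event to be neglected is not visibly measurable. It is enclosed in
    a measurable set, built from rational translations, that still has countable fibres in [p3]. Two
    level curves share no arc because each one reaches height [0] exactly at the ends of its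
    interval: curves with a common arc would have the same ends, hence the same centre. *)

Section PowerSeries.
Variable R : realType.
Implicit Types (r M x : R) (c : nat -> R) (f g : R -> R).

Definition psum c x n : R := \sum_(k < n) c k * x ^+ k.

(* f is, on ]-r, r[, the sum of a power series c with sum_k |c k| r^k <= M; convergence is expressed
   by the geometric bound on the remainders that this implies. *)
Definition ana r M f := 0 < r /\ exists c,
  (forall n, psum (fun k => `|c k|) r n <= M) /\
  (forall x, `|x| < r -> forall n, `|f x - psum c x n| <= M * (`|x| / r) ^+ n).

Lemma psumS c x n : psum c x n.+1 = psum c x n + c n * x ^+ n.
Proof. by rewrite /psum big_ord_recr. Qed.

Lemma psum0 c x : psum c x 0 = 0.
Proof. by rewrite /psum big_ord0. Qed.

Lemma ratio_itv x r : `|x| < r -> 0 <= `|x| / r < 1.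
Proof.
move=> xr; have r0 : 0 < r by apply: le_lt_trans xr.
by rewrite divr_ge0 ?(ltW r0)//= ltr_pdivrMr// mul1r.
Qed.

Lemma ana_gt0 r M f : ana r M f -> 0 < r. Proof. by case. Qed.

Lemma ana_ge0 r M f : ana r M f -> 0 <= M.
Proof. by move=> [_ [c [cM _]]]; have := cM 0%N; rewrite psum0. Qed.

Lemma ana_bound r M f x : ana r M f -> `|x| < r -> `|f x| <= M.
Proof.
by move=> [_ [c [_ cf]]] xr; have := cf x xr 0%N; rewrite psum0 subr0 expr0 mulr1.
Qed.

Lemma eq_ana r M f g : (forall x, `|x| < r -> f x = g x) -> ana r M f -> ana r M g.
Proof.
by move=> fg [r0 [c [cM cf]]]; split=> //; exists c; split=> // x xr n; rewrite -fg// cf.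
Qed.

Lemma ana_le r M M' f : M <= M' -> ana r M f -> ana r M' f.
Proof.
move=> MM' [r0 [c [cM cf]]]; split=> //; exists c; split=> [n|x xr n].
  exact: le_trans MM'.
have /andP[q0 _] := ratio_itv xr.
by apply: (le_trans (cf x xr n)); rewrite ler_wpM2r// exprn_ge0.
Qed.

Lemma ana_add r M M' f g : ana r M f -> ana r M' g -> ana r (M + M') (fun x => f x + g x).
Proof.
have psumD c d x n : psum (fun k => c k + d k) x n = psum c x n + psum d x n.
  by rewrite /psum -big_split/=; apply: eq_bigr => i _; rewrite mulrDl.
move=> [r0 [c [cM cf]]] [_ [d [dM dg]]]; split=> //.
exists (fun k => c k + d k); split=> [n|x xr n].
  apply: le_trans (lerD (cM n) (dM n)); rewrite -psumD /psum.
  by apply: ler_sum => i _; rewrite ler_wpM2r ?exprn_ge0 ?(ltW r0)// ler_normD.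
rewrite psumD opprD addrACA mulrDl; apply: (le_trans (ler_normD _ _)).
by apply: lerD; [exact: cf|exact: dg].
Qed.

Lemma ana_scale r M f a : ana r M f -> ana r (`|a| * M) (fun x => a * f x).
Proof.
have psumZ b c x n : psum (fun k => b * c k) x n = b * psum c x n.
  by rewrite /psum mulr_sumr; apply: eq_bigr => i _; rewrite mulrA.
move=> [r0 [c [cM cf]]]; split=> //; exists (fun k => a * c k); split=> [n|x xr n].
  under [fun k => `|_|]eq_fun do rewrite normrM.
  by rewrite psumZ ler_wpM2l.
by rewrite psumZ -mulrBr normrM -mulrA ler_wpM2l// cf.
Qed.

Lemma ana_opp r M f : ana r M f -> ana r M (fun x => - f x).
Proof.
move=> /(ana_scale (-1)); rewrite normrN1 mul1r.
by apply: eq_ana => x _; rewrite mulN1r.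
Qed.

Lemma ana_sub r M M' f g : ana r M f -> ana r M' g -> ana r (M + M') (fun x => f x - g x).
Proof. by move=> af /ana_opp; exact: ana_add. Qed.

Lemma ana_cst r a : 0 < r -> ana r `|a| (fun=> a).
Proof.
move=> r0.
have E b x n : psum (fun k => if k is 0%N then b else 0) x n.+1 = b.
  elim: n => [|n IH]; first by rewrite psumS psum0 add0r expr0 mulr1.
  by rewrite psumS IH mul0r addr0.
split=> //; exists (fun k => if k is 0%N then a else 0); split=> [[|n]|x xr [|n]].
- by rewrite psum0.
- rewrite (_ : (fun k => _) = (fun k => if k is 0%N then `|a| else 0)) ?E//.
  by apply/funext => -[|k]//; rewrite normr0.
- by rewrite psum0 subr0 expr0 mulr1.
- have /andP[q0 _] := ratio_itv xr.
  by rewrite E subrr normr0 mulr_ge0// exprn_ge0.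
Qed.

Lemma ana_mulX r M f : ana r M f -> ana r (r * M) (fun x => x * f x).
Proof.
have E c x n : psum (fun k => if k is k'.+1 then c k' else 0) x n.+1 = x * psum c x n.
  elim: n => [|n IH]; first by rewrite psumS !psum0 mul0r mulr0 addr0.
  by rewrite psumS IH psumS mulrDr exprS [c n * _]mulrCA.
move=> [r0 [c [cM cf]]]; split=> //.
exists (fun k => if k is k'.+1 then c k' else 0); split=> [[|n]|x xr n].
- by rewrite psum0 mulr_ge0 ?(ltW r0)//; have := cM 0%N; rewrite psum0.
- rewrite (_ : (fun k => _) = (fun k => if k is k'.+1 then `|c k'| else 0)).
    by rewrite E ler_wpM2l// ltW.
  by apply/funext => -[|k]//; rewrite normr0.
- case: n => [|n].
    rewrite psum0 subr0 expr0 mulr1 normrM ler_pM//; first exact: ltW.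
    by have := cf x xr 0%N; rewrite psum0 subr0 expr0 mulr1.
  rewrite E -mulrBr normrM exprS.
  rewrite [leRHS](_ : _ = `|x| * (M * (`|x| / r) ^+ n)); last by field; rewrite gt_eqF.
  by rewrite ler_wpM2l// cf.
Qed.

Lemma ana_id r : 0 < r -> ana r r (fun x => x).
Proof.
move=> r0; have := ana_mulX (ana_cst 1 r0); rewrite normr1 mulr1.
by apply: eq_ana => x _; rewrite mulr1.
Qed.

Lemma ana_sum r (M : nat -> R) (F : nat -> R -> R) n : 0 < r ->
  (forall i, (i < n)%N -> ana r (M i) (F i)) ->
  ana r (\sum_(i < n) M i) (fun x => \sum_(i < n) F i x).
Proof.
move=> r0; elim: n => [|n IH] aF.
  have := ana_cst 0 r0; rewrite big_ord0 normr0.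
  by apply: eq_ana => x _; rewrite big_ord0.
rewrite big_ord_recr/=.
apply: (@eq_ana _ _ (fun x => \sum_(i < n) F i x + F n x)) => [x _|].
  by rewrite big_ord_recr.
by apply: ana_add; [apply: IH => i ni; apply: aF; exact: ltnW|exact: aF].
Qed.

Lemma ana_mulXn r M f n : ana r M f -> ana r (r ^+ n * M) (fun x => x ^+ n * f x).
Proof.
move=> af; elim: n => [|n IH].
  by rewrite expr0 mul1r; apply: eq_ana af => x _; rewrite expr0 mul1r.
by rewrite exprS -mulrA; apply: eq_ana (ana_mulX IH) => x _; rewrite exprS mulrA.
Qed.

(* Montel: along an ultrafilter the coefficients converge, being bounded. *)
Lemma ana_cvg r M (F : nat -> R -> R) f :
  (forall i, ana r M (F i)) -> (forall x, `|x| < r -> F i x @[i --> \oo] --> f x) ->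
  ana r M f.
Proof.
move=> aF Ff; have r0 : 0 < r by case: (aF 0%N).
split=> //.
have [C HC] := choice (fun i => (aF i).2).
have [U [UU infU]] := @ultraFilterLemma nat \oo _.
have UP : ProperFilter U by case: UU.
have M0 : 0 <= M by exact: ana_ge0 (aF 0%N).
have Cb i k : `|C i k| * r ^+ k <= M.
  have [+ _] := HC i => /(_ k.+1); rewrite psumS; apply: le_trans.
  rewrite lerDr /psum sumr_ge0// => j _; rewrite mulr_ge0// exprn_ge0//; exact: ltW.
have cP k : exists l : R, C i k @[i --> U] --> l.
  pose b := M / r ^+ k.
  have bC i : `[- b, b]%classic (C i k).
    by rewrite /= in_itv/= -ler_norml /b ler_pdivlMr ?exprn_gt0.
  have [|l [_ Hl]] := @segment_compact R (- b) b (C i k @[i --> U]) _.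
    exact: (@filterE _ U _ _ bC).
  exists l => A Al; have [//|UA] := in_ultra_setVsetC ((C ^~ k) @^-1` A) UU.
  by have [y []] := Hl (~` A) A UA Al.
have [c {}cP] := choice cP.
have psumU (d : nat -> nat -> R) (e : nat -> R) x n : (forall k, d i k @[i --> U] --> e k) ->
    psum (d i) x n @[i --> U] --> psum e x n.
  move=> de; elim: n => [|n IH].
    by under eq_fun do rewrite psum0; rewrite psum0; exact: cvg_cst.
  under eq_fun do rewrite psumS; rewrite psumS; apply: cvgD => //.
  by apply: cvgM => //; exact: cvg_cst.
exists c; split=> [n|x xr n].
  apply: (@cvgr_to_le _ U _ R (fun i => psum (fun k => `|C i k|) r n)).
    by apply: (psumU (fun i k => `|C i k|)) => k; apply: cvg_norm.
  by apply: filterE => i; have [+ _] := HC i; exact.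
apply: (@cvgr_to_le _ U _ R (fun i => `|F i x - psum (C i) x n|)).
  apply: cvg_norm; apply: cvgB; last exact: psumU.
  by apply: cvg_trans (Ff x xr); apply: cvg_app.
by apply: filterE => i; have [_] := HC i; exact.
Qed.

Lemma ana_cvg_psum r M c f x : (forall n, `|f x - psum c x n| <= M * (`|x| / r) ^+ n) ->
  `|x| < r -> psum c x n @[n --> \oo] --> f x.
Proof.
move=> H xr; have /andP[q0 q1] := ratio_itv xr.
apply/cvgrPdist_le => e e0; near=> n.
apply: (le_trans (H n)).
have : `|0 - M * (`|x| / r) ^+ n| <= e.
  near: n; apply: cvgr_dist_le => //.
  by rewrite -(mulr0 M); apply: cvgMl_tmp; apply: cvg_expr; rewrite ger0_norm.
by rewrite sub0r normrN; apply: le_trans; exact: ler_norm.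
Unshelve. all: by end_near. Qed.

(** No Cauchy product is formed: [f] times a partial sum of [g] is bounded term by term, in total by
    [M * M'], and [ana_cvg] passes to the limit. *)
Lemma ana_mul r M M' f g : ana r M f -> ana r M' g -> ana r (M * M') (fun x => f x * g x).
Proof.
move=> af [r0 [d [dM dg]]].
apply: (@ana_cvg _ _ (fun n x => f x * psum d x n)) => [n|x xr]; last first.
  by apply: cvgMl_tmp; exact: (ana_cvg_psum (dg x xr)).
apply: (@ana_le _ (\sum_(k < n) `|d k| * (r ^+ k * M))).
  rewrite [leLHS](_ : _ = M * psum (fun k => `|d k|) r n).
    by rewrite ler_wpM2l// (ana_ge0 af).
  by rewrite /psum mulr_sumr; apply: eq_bigr => i _; ring.
apply: (@eq_ana _ _ (fun x => \sum_(k < n) d k * (x ^+ k * f x))) => [x xr|].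
  by rewrite /psum mulr_sumr; apply: eq_bigr => i _; ring.
apply: (@ana_sum r (fun k => `|d k| * (r ^+ k * M)) (fun k x => d k * (x ^+ k * f x))) => // i _.
by apply: (@ana_scale r _ (fun x => x ^+ i * f x)); exact: ana_mulXn.
Qed.

Lemma ana_exprn r M f n : ana r M f -> ana r (M ^+ n) (fun x => f x ^+ n).
Proof.
move=> af; elim: n => [|n IH].
  have := ana_cst 1 (ana_gt0 af); rewrite normr1.
  by apply: eq_ana => x _; rewrite expr0.
by rewrite exprS; apply: eq_ana (ana_mul af IH) => x _; rewrite exprS.
Qed.

End PowerSeries.

(** * Inverse, square root and exponential; isolated zeros *)

Section Analytic.
Variable R : realType.
Implicit Types (r M x : R) (f g z : R -> R).

(* Picard iteration: pointwise contraction together with norm boundedness suffices, by Montel. *)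
Lemma ana_picard r M (Phi : (R -> R) -> R -> R) f : 0 < r -> 0 <= M ->
  (forall g, ana r M g -> ana r M (Phi g)) ->
  (forall g x, ana r M g -> `|x| < r -> `|Phi g x - f x| <= 2^-1 * `|g x - f x|) ->
  ana r M f.
Proof.
move=> r0 M0 PhiM Phic; pose F n := iter n Phi (fun=> 0).
have aF n : ana r M (F n).
  elim: n => [|n /PhiM//]; apply: ana_le M0 _.
  by have := ana_cst 0 r0; rewrite normr0.
apply: (ana_cvg aF _) => x xr.
have Fx n : `|F n x - f x| <= `|f x| * 2^-1 ^+ n.
  elim: n => [|n IH]; first by rewrite /F/= sub0r normrN expr0 mulr1.
  apply: (le_trans (Phic _ _ (aF n) xr)).
  by rewrite exprS mulrCA ler_wpM2l.
apply/cvgrPdist_le => e e0; near=> n; rewrite distrC.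
apply: (le_trans (Fx n)).
have : `|0 - `|f x| * 2^-1 ^+ n| <= e.
  near: n; apply: cvgr_dist_le => //.
  rewrite -(mulr0 `|f x|); apply: cvgMl_tmp; apply: cvg_expr.
  by rewrite ger0_norm ?invr_ge0// invf_lt1// ltr1n.
by rewrite sub0r normrN; apply: le_trans; exact: ler_norm.
Unshelve. all: by end_near. Qed.

(** The function is the fixed point of [g |-> - z (1 + g)], a contraction since [|z| <= 2^-1]; the
    bound [2 M] is preserved since [M (1 + 2 M) <= 2 M]. *)
Lemma ana_inv1D r M z : ana r M z -> M <= 2^-1 ->
  ana r (2 * M) (fun x => (1 + z x)^-1 - 1).
Proof.
move=> az M2; have M0 := ana_ge0 az; have r0 := ana_gt0 az.
have a1 : ana r 1 (fun=> 1) by have := ana_cst 1 r0; rewrite normr1.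
apply: (@ana_picard _ _ (fun g x => - (z x * (1 + g x)))) => //; first by rewrite mulr_ge0.
  move=> g ag; apply: ana_opp; apply: ana_le (ana_mul az (ana_add a1 ag)).
  by rewrite mulrC ler_wpM2r//; lra.
move=> g x ag xr.
have zx : `|z x| <= 2^-1 by apply: le_trans (ana_bound az xr) _.
have z1 : 1 + z x != 0.
  by rewrite gt_eqF//; move: zx; rewrite ler_norml => /andP[? ?]; lra.
rewrite (_ : - _ - _ = - z x * (g x - ((1 + z x)^-1 - 1))); last by field.
by rewrite normrM normrN ler_wpM2r.
Qed.

(** With [w = Num.sqrt (1 + z) - 1], the relation [w ^+ 2 + 2 w = z] makes [w] the fixed point of
    [g |-> (z - g ^+ 2) / 2]. *)
Lemma ana_sqrt1D r M z : ana r M z -> M <= 2^-1 ->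
  ana r M (fun x => Num.sqrt (1 + z x) - 1).
Proof.
move=> az M2; have M0 := ana_ge0 az; have r0 := ana_gt0 az.
apply: (@ana_picard _ _ (fun g x => 2^-1 * (z x - g x * g x))) => //.
  move=> g ag.
  apply: ana_le (ana_scale 2^-1 (ana_sub az (ana_mul ag ag))).
  by rewrite ger0_norm//; nra.
move=> g x ag xr.
have zx : `|z x| <= 2^-1 by apply: le_trans (ana_bound az xr) _.
have gx : `|g x| <= 2^-1 by apply: le_trans (ana_bound ag xr) _.
set w := Num.sqrt (1 + z x).
have w0 : 0 <= w by exact: sqrtr_ge0.
have wE : w ^+ 2 = 1 + z x.
  by rewrite sqr_sqrtr//; move: zx; rewrite ler_norml => /andP[? ?]; lra.
have w2 : `|w - 1| <= 2^-1.
  move: zx; rewrite !ler_norml => /andP[? ?]; apply/andP; split; nra.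
rewrite (_ : _ - _ = - (2^-1 * ((g x + (w - 1)) * (g x - (w - 1))))); last first.
  have -> : z x = w ^+ 2 - 1 by rewrite wE; ring.
  by field.
rewrite normrN normrM ger0_norm// ler_wpM2l// normrM ler_piMl//.
by apply: (le_trans (ler_normD _ _)); lra.
Qed.

Lemma ana_expR r M z : ana r M z -> M <= 1 -> ana r (2 * M) (fun x => expR (z x) - 1).
Proof.
move=> az M1; have M0 := ana_ge0 az; have r0 := ana_gt0 az.
pose F n x : R := \sum_(k < n) (k.+1`!%:R^-1 * z x ^+ k.+1).
apply: (@ana_cvg _ _ _ F) => [n|x xr].
  have := @ana_sum _ r (fun k => `|k.+1`!%:R^-1| * M ^+ k.+1)
    (fun k x => k.+1`!%:R^-1 * z x ^+ k.+1) n r0.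
  move=> /(_ (fun i _ => ana_scale _ (ana_exprn _ az))); apply: ana_le.
  (* As [2 ^ k <= (k + 1)!] and [M <= 1], the terms are dominated by a geometric series of sum
     [2 M]. *)
  have H k : `|k.+1`!%:R^-1| * M ^+ k.+1 <= M * 2^-1 ^+ k.
    rewrite ger0_norm ?invr_ge0 ?ler0n// exprS mulrCA ler_wpM2l//.
    have Mk : M ^+ k <= 1 by rewrite exprn_ile1.
    have : (2 ^ k <= k.+1`!)%N.
      elim: k {Mk} => // k IH; rewrite expnS factS; exact: leq_mul.
    rewrite -(ler_nat R) natrX => H2.
    apply: (@le_trans _ _ (k.+1`!%:R^-1)).
      by rewrite ler_piMr// invr_ge0 ler0n.
    by rewrite exprVn lef_pV2// posrE ?exprn_gt0// ltr0n fact_gt0.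
  apply: (@le_trans _ _ (\sum_(k < n) M * 2^-1 ^+ k)); first by apply: ler_sum => k _; exact: H.
  have -> : \sum_(k < n) M * 2^-1 ^+ k = M * (2 - 2 * 2^-1 ^+ n).
    elim: n {F} => [|n IH]; first by rewrite big_ord0 expr0; ring.
    by rewrite big_ord_recr/= IH exprS; field.
  by rewrite mulrC ler_wpM2r// gerBl mulr_ge0// exprn_ge0.
have /cvg_ex[l Hl] := @is_cvg_series_exp_coeff R (z x).
have -> : expR (z x) = l by rewrite /expR; apply/cvg_lim.
have FE n : F n x = series (exp_coeff (z x)) n.+1 - 1.
  rewrite /series/= big_nat_recl//= /exp_coeff/= expr0 fact0 divr1 [1 + _]addrC addrK big_mkord.
  by apply: eq_bigr => i _; rewrite mulrC.
under eq_fun do rewrite FE.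
apply: cvgB; last exact: cvg_cst.
by have := Hl; rewrite -(cvg_shiftS (series (exp_coeff (z x)))).
Qed.

Lemma ana_lip0 r M f x : ana r M f -> `|x| < r -> `|f x - f 0| <= 2 * M * (`|x| / r).
Proof.
move=> af xr; have M0 := ana_ge0 af; have [r0 [c [cM cf]]] := af.
have := cf x xr 1%N; have := cf 0 _ 1%N; rewrite normr0 mul0r expr1 mulr0 => /(_ r0).
rewrite normr_le0 subr_eq0 => /eqP ->; rewrite !psumS !psum0 !expr0 expr1 => h.
have /andP[q0 _] := ratio_itv xr.
by apply: (le_trans h); rewrite ler_wpM2r//; lra.
Qed.

Lemma ana_isolated r M f : ana r M f -> (forall x, `|x| < r -> f x = 0) \/
  exists2 e, 0 < e & forall x, 0 < `|x| < e -> f x != 0.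
Proof.
move=> af; have M0 := ana_ge0 af; have [r0 [c [cM cf]]] := af.
have [[k ck]|/forallNP c0] := pselect (exists k, c k != 0); last first.
  left=> x xr.
  have p0 n : psum c x n = 0.
    elim: n => [|n IH]; first by rewrite psum0.
    by rewrite psumS IH add0r; have /negP := c0 n; rewrite negbK => /eqP ->; rewrite mul0r.
  have := ana_cvg_psum (cf x xr) xr; under eq_fun do rewrite p0.
  by move=> H; apply: (cvg_unique _ H); [exact: norm_hausdorff|exact: cvg_cst].
have [m cm mmin] := @ex_minnP (fun k => c k != 0) (ex_intro _ k ck).
right; pose b := `|c m| * r ^+ m.+1 / (M + 1).
(* [m] is the index of the first nonzero coefficient. Its term exceeds the remainder
   [M (|x| / r) ^+ m.+1] when [|x| < b]; the [+ 1] keeps the denominator positive when [M = 0]. *)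
have b0 : 0 < b by rewrite divr_gt0// ?mulr_gt0 ?exprn_gt0 ?normr_gt0//; lra.
exists (Num.min r b); first by rewrite lt_min r0 b0.
move=> x /andP[x0]; rewrite lt_min => /andP[xr xb]; apply/eqP => fx.
have pm n : (n <= m)%N -> psum c x n = 0.
  elim: n => [|n IH] nm; first by rewrite psum0.
  rewrite psumS IH ?(ltnW nm)// add0r.
  have [->|cn] := eqVneq (c n) 0; first by rewrite mul0r.
  by have := mmin _ cn; rewrite leqNgt nm.
have := cf x xr m.+1; rewrite fx sub0r psumS (pm _ (leqnn m)) add0r normrN normrM normrX.
apply/negP; rewrite -ltNge expr_div_n (exprSr `|x|) -mulrA mulrCA.
rewrite [X in _ < X]mulrC ltr_pM2l ?exprn_gt0//.
move: xb; rewrite /b ltr_pdivlMr ?ltr_pwDr// => xb.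
rewrite mulrA ltr_pdivrMr ?exprn_gt0// (le_lt_trans _ xb)// mulrDr mulr1.
by rewrite [M * _]mulrC lerDl.
Qed.

Lemma ana_shrink r r' M f : 0 < r' <= r -> ana r M f -> ana r' M f.
Proof.
move=> /andP[r'0 rr] [r0 [c [cM cf]]]; split=> //; exists c; split=> [n|x xr n].
  apply: le_trans (cM n); apply: ler_sum => i _.
  by rewrite ler_wpM2l// lerXn2r// nnegrE ltW.
apply: (le_trans (cf x (lt_le_trans xr rr) n)).
rewrite ler_wpM2l//; first by have := cM 0%N; rewrite psum0.
by rewrite lerXn2r// ?nnegrE ?divr_ge0 ?(ltW r0) ?(ltW r'0)// ler_wpM2l// lef_pV2.
Qed.

Definition analytic_at f a := exists r M, ana r M (fun x => f (a + x)).

Lemma analytic_at_continuous f a : analytic_at f a -> {for a, continuous f}.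
Proof.
move=> [r [M af]]; apply/cvgrPdist_lt => e e0.
have r0 := ana_gt0 af; have M0 := ana_ge0 af.
pose d := Num.min r (e * r / (2 * M + 1)).
have d0 : 0 < d by rewrite lt_min r0 divr_gt0 ?mulr_gt0//; lra.
exists d => //= y; rewrite /ball/= distrC => ay.
move: (ay); rewrite lt_min => /andP[yr ye].
have := ana_lip0 af yr; rewrite addr0 [a + _]addrC subrK distrC => /le_lt_trans; apply.
move: ye; rewrite ltr_pdivlMr; last by lra.
rewrite mulrA ltr_pdivrMr// => ye; rewrite (le_lt_trans _ ye)// mulrC ler_wpM2l//; lra.
Qed.

Lemma analytic_at_sub f g a : analytic_at f a -> analytic_at g a ->
  analytic_at (fun x => f x - g x) a.
Proof.
move=> [r [M af]] [r' [M' ag]].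
have r0 := ana_gt0 af; have r'0 := ana_gt0 ag.
exists (Num.min r r'), (M + M'); apply: ana_sub.
  by apply: ana_shrink af; rewrite lt_min r0 r'0 ge_min lexx.
by apply: ana_shrink ag; rewrite lt_min r0 r'0 ge_min lexx orbT.
Qed.

Lemma analytic_zeros_countable (A : set R) f : open A -> is_interval A ->
  (forall x, A x -> analytic_at f x) -> (exists2 x, A x & f x != 0) ->
  countable (A `&` [set x | f x = 0]).
Proof.
move=> oA iA aA [x1 Ax1 fx1].
(* [B] is open and closed in the connected set [A] and misses [x1], so it is empty and all zeros are
   isolated. *)
pose B := [set x | A x /\ \forall y \near x, f y = 0].
have dich x : A x -> B x \/ exists2 e, 0 < e & forall y, 0 < `|y - x| < e -> f y != 0.
  move=> Ax; have [r [M af]] := aA x Ax.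
  have [H|[e e0 H]] := ana_isolated af; [left; split=> //|right].
    exists r => [|y]; first exact: ana_gt0 af.
    by rewrite /ball/= distrC => /H; rewrite addrC subrK.
  by exists e => // y /H; rewrite addrC subrK.
have B0 x : ~ B x.
  move=> Bx; have BA : B = A.
    have /connected_intervalP cA := iA.
    apply: cA; first by exists x.
      exists [set x | \forall y \near x, f y = 0]; last by rewrite predeqE => y.
      move=> y [e /= e0 ey]; exists (e / 2) => /=; first by rewrite divr_gt0.
      move=> u; rewrite /ball/= => yu; exists (e / 2) => /=; first by rewrite divr_gt0.
      move=> v; rewrite /ball/= => uv; apply: ey; rewrite /ball/=.
      rewrite (_ : y - v = y - u + (u - v)); last by ring.
      by apply: (le_lt_trans (ler_normD _ _)); lra.
    exists (closure B); first exact: closed_closure.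
    apply/seteqP; split=> y; first by move=> By; split; [case: By|exact: subset_closure].
    move=> [Ay cy]; have [//|[e e0 H]] := dich y Ay.
    have [z [[Az Bz] yz]] := cy _ (nbhsx_ballx y e e0).
    have [zy|zy] := eqVneq z y; first by rewrite -zy.
    have /eqP[] : f z != 0 by apply: H; rewrite normr_gt0 subr_eq0 zy distrC.
    exact: nbhs_singleton Bz.
  have [_ /nbhs_singleton f0] : B x1 by rewrite BA.
  by move/eqP: fx1.
set Z := A `&` _.
(* Each zero is alone between two suitable rationals, so pairs of rationals index the zeros. *)
pose S (pq : rat * rat) := [set x | Z x /\ ratr pq.1 < x < ratr pq.2 /\
  forall y, Z y -> ratr pq.1 < y < ratr pq.2 -> y = x].
apply: (@sub_countable _ _ _ (\bigcup_(pq in [set: rat * rat]) S pq)); last first.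
  apply: bigcup_countable => [|pq _]; first exact: countableP.
  have [[x Sx]|/forallNP S0] := pselect (exists x, S pq x).
    apply: (@sub_countable _ _ _ [set x]); last exact: countable1.
    apply: subset_card_le => y [Zy [yi _]].
    by case: Sx => _ [_ /(_ y Zy yi)].
  by rewrite (_ : S pq = set0) ?countable0// predeqE => x; split=> // /S0.
apply: subset_card_le => x Zx; have [Bx|[e e0 H]] := dich x Zx.1; first by case: (B0 x).
have [p /= /itvP px] : exists p : rat, ratr p \in `](x - e), x[ by apply: rat_in_itvoo; lra.
have [q /= /itvP qx] : exists q : rat, ratr q \in `]x, (x + e)[ by apply: rat_in_itvoo; lra.
exists (p, q) => //=; split=> //; split=> [|y [_ fy] /andP[py yq]]; first by rewrite px qx.
apply/eqP; apply: contraTT isT => yx.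
suff /eqP[] : f y != 0 by exact: fy.
apply: H; rewrite normr_gt0 subr_eq0 yx/= ltr_norml; apply/andP; split.
  by have : x - e < ratr p; [rewrite px|lra].
by have : ratr q < x + e; [rewrite qx|lra].
Qed.

End Analytic.

(** * The window integral of the photon rate *)

Section Riemann.
Variable R : realType.
Implicit Types (f F : R -> R).

Lemma heine01 f e : 0 < e -> (forall u, 0 <= u <= 1 -> {for u, continuous f}) ->
  exists2 d, 0 < d & forall u v, 0 <= u <= 1 -> `|u - v| < d -> `|f u - f v| < e.
Proof.
move=> e0 cf.
have /compact_near_coveringP cK := @segment_compact R 0 1.
pose P (d u : R) := forall v, `|u - v| < d -> `|f u - f v| < e.
have [|d /= d0 dP] := cK R (0^'+) P _.
  move=> x; rewrite /= in_itv/= => /cf /cvgrPdist_lt /(_ (e / 2)) [|r /= r0 rf].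
    by rewrite divr_gt0.
  exists (ball x (r / 2), [set d | d < r / 2]).
    by split; [apply: nbhsx_ballx; rewrite divr_gt0|apply: nbhs_right_lt; rewrite divr_gt0].
  move=> [u d]/= [xu dr] v uv; rewrite /ball/= in xu.
  have xv : `|x - v| < r.
    by rewrite -(subrK u x) -addrA (le_lt_trans (ler_normD _ _))//; lra.
  have xu' : `|x - u| < r by lra.
  have := rf _ xv; have := rf _ xu'; rewrite [`|_ - f u|]distrC => h1 h2.
  by rewrite -(subrK (f x) (f u)) -addrA (le_lt_trans (ler_normD _ _))//; lra.
have d2 : 0 < d / 2 by rewrite divr_gt0.
exists (d / 2) => // u v u01 uv.
apply: (dP (d / 2) _ d2 u _ v) => //.
by rewrite /ball/= sub0r normrN gtr0_norm//; lra.
Qed.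

(** Finite sums keep the [ana] bounds, so these limits carry analyticity through an integral. The
    limit is expressed by a primitive, whose increments the mean value theorem compares with the sum
    on each cell. *)
Lemma riemann01 f F :
  (forall u : R, 0 <= u <= 1 -> {for u, continuous f}) ->
  (forall u : R, 0 <= u <= 1 -> is_derive u 1 F (f u)) ->
  n.+1%:R^-1 * \sum_(i < n.+1) f (i%:R / n.+1%:R) @[n --> \oo] --> F 1 - F 0.
Proof.
move=> cf dF; apply/cvgrPdist_le => e e0.
have [d d0 fd] := heine01 e0 cf.
near=> n.
have : (n.+1%:R : R)^-1 < d.
  near: n; have [k _ kd] := near_infty_natSinv_lt (PosNum d0).
  by exists k => // j /kd.
set m : R := n.+1%:R => md; have m0 : 0 < m by rewrite ltr0n.
have tele : F 1 - F 0 = \sum_(i < n.+1) (F (i.+1%:R / m) - F (i%:R / m)).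
  rewrite -(big_mkord xpredT (fun i => F (i.+1%:R / m) - F (i%:R / m))).
  by rewrite telescope_sumr// mul0r divff// gt_eqF.
rewrite tele mulr_sumr -sumrB (le_trans (ler_norm_sum _ _ _))//.
rewrite (_ : e = \sum_(i < n.+1) (m^-1 * e)); last first.
  by rewrite sumr_const card_ord -mulr_natl mulrA divff ?mul1r// gt_eqF.
apply: ler_sum => i _.
have i01 u : i%:R / m <= u <= i.+1%:R / m -> 0 <= u <= 1.
  move=> /andP[u1 u2]; rewrite (le_trans _ u1) ?divr_ge0 ?(ltW m0)//=.
  by rewrite (le_trans u2)// ler_pdivrMr// mul1r ler_nat.
have im : i%:R / m < i.+1%:R / m by rewrite ltr_pM2r ?invr_gt0// ltr_nat.
have [||x xi ->] := @MVT _ F f _ _ im.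
- by move=> x /itvP xi; apply: dF; apply: i01; rewrite !ltW ?xi.
- apply: derivable_within_continuous => x; rewrite in_itv/= => /i01 x01.
  by have := dF _ x01; case.
rewrite -mulrBl -natrB// subSnn mul1r mulrC -mulrBr normrM gtr0_norm ?invr_gt0//.
rewrite ler_wpM2l ?invr_ge0 ?(ltW m0)// ltW//; move/itvP: xi => xi.
apply: fd; first by apply: i01; rewrite !ltW ?xi.
rewrite (lt_trans _ md)// ger0_norm ?subr_ge0 ?(ltW _) ?xi//.
rewrite ltrBlDr -[X in X + _]mul1r -mulrDl nat1r.
by rewrite xi.
Unshelve. all: by end_near. Qed.

End Riemann.

Section Kernel.
Variables (R : realType) (al s : R).
Hypotheses (al0 : 0 <= al) (s0 : 0 < s).
Implicit Types (e h t x y : R).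
Local Notation mu := (@lebesgue_measure R).

Definition rate e t : R :=
  expR (- al * Num.sqrt (e ^+ 2 + (s * t) ^+ 2)) / (e ^+ 2 + (s * t) ^+ 2).

(** The function [F] of the overview, with [e] the signed distance and [h] the time since the
    closest approach. *)
Definition erate_int e h : \bar R := (\int[mu]_(t in `[(h - 2^-1)%R, (h + 2^-1)%R]) (rate e t)%:E)%E.

(** Infinite integrals become [0] here; [regular] below excludes them. *)
Definition rate_int e h : R := fine (erate_int e h).

(** The derivative of [rate_int e] at [h]. *)
Definition rate_jump e h : R := rate e (h + 2^-1) - rate e (h - 2^-1).

Lemma sumsq_gt0 e t : e != 0 \/ t != 0 -> 0 < e ^+ 2 + (s * t) ^+ 2.
Proof.
case=> [e0|t0].
  by rewrite ltr_pwDl ?sqr_ge0// exprn_even_gt0.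
by rewrite ltr_wpDl ?sqr_ge0// exprn_even_gt0//= mulf_neq0// gt_eqF.
Qed.

Lemma rate_ge0 e t : 0 <= rate e t.
Proof. by rewrite divr_ge0 ?expR_ge0// addr_ge0 ?sqr_ge0. Qed.

Lemma rate_lt e t e' t' : e ^+ 2 + (s * t) ^+ 2 < e' ^+ 2 + (s * t') ^+ 2 ->
  0 < e ^+ 2 + (s * t) ^+ 2 -> rate e' t' < rate e t.
Proof.
move=> lt q0; have q'0 := lt_trans q0 lt.
apply: (@le_lt_trans _ _ (expR (- al * Num.sqrt (e ^+ 2 + (s * t) ^+ 2)) / (e' ^+ 2 + (s * t') ^+ 2))).
  rewrite ler_pM2r ?invr_gt0// ler_expR !mulNr lerN2 ler_wpM2l// ler_wsqrtr//; exact: ltW.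
by rewrite ltr_pM2l ?expR_gt0// ltf_pV2.
Qed.

Lemma rate_normr e t : rate `|e| t = rate e t.
Proof. by rewrite /rate real_normK ?num_real. Qed.

Lemma rate_le_inv e t : rate e t <= (e ^+ 2 + (s * t) ^+ 2)^-1.
Proof.
rewrite ler_piMl ?invr_ge0 ?addr_ge0 ?sqr_ge0//.
by rewrite -expR0 ler_expR mulNr oppr_le0 mulr_ge0// sqrtr_ge0.
Qed.

Lemma rate_continuous e t : e != 0 \/ t != 0 -> {for t, continuous (rate e)}.
Proof.
move=> /sumsq_gt0 q0.
have cq : {for t, continuous (fun t => e ^+ 2 + (s * t) ^+ 2)}.
  apply: cvgD; first exact: cvg_cst.
  apply: (@continuous_comp _ _ _ ( *%R s) (fun u : R => u ^+ 2)); last exact: exprn_continuous.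
  exact: mulrl_continuous.
apply: cvgM; last by apply: cvgV => //; rewrite gt_eqF.
apply: (@continuous_comp _ _ _ (fun t => - al * Num.sqrt (e ^+ 2 + (s * t) ^+ 2)) expR);
  last exact: continuous_expR.
apply: cvgMl_tmp.
by apply: (@continuous_comp _ _ _ (fun t => e ^+ 2 + (s * t) ^+ 2) Num.sqrt);
  last exact: sqrt_continuous.
Qed.

Lemma rate_primitive e b : e != 0 \/ 0 < b -> exists N : R -> R,
  (forall x, b < x -> is_derive x 1 N (rate e x)) /\
  (forall x y, b < x -> x < y ->
    (\int[mu]_(t in `[x, y]) (rate e t)%:E)%E = (N y - N x)%:E).
Proof.
move=> reg.
have ck x : b <= x -> {for x, continuous (rate e)}.
  move=> bx; apply: rate_continuous; case: reg => [|b0]; [by left|right].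
  by rewrite gt_eqF// (lt_le_trans b0).
pose N (x : R) : R := (\int[mu]_(t in `[b, x]) rate e t)%R.
have dN x : b < x -> is_derive x 1 N (rate e x).
  move=> bx; have xx1 : x < x + 1 by rewrite ltrDl.
  have [|||dF F'] := @continuous_FTC1 R (rate e) (BLeft b) x (x + 1) xx1.
  - apply: continuous_compact_integrable; first exact: segment_compact.
    apply: continuous_in_subspaceT => u /[!inE]/=; rewrite in_itv/= => /andP[bu _].
    exact: ck.
  - by rewrite /= lte_fin.
  - by apply: ck; exact: ltW.
  - by apply: DeriveDef; [exact: dF|rewrite -F' derive1E].
exists N; split=> // x y bx xy.
rewrite (@continuous_FTC2 R (rate e) N)//.
- apply: continuous_in_subspaceT => u /[!inE]/=; rewrite in_itv/= => /andP[xu _].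
  by apply: ck; rewrite (le_trans _ xu)// ltW.
- have cN u : b < u -> N u' @[u' --> u] --> N u.
    move=> /dN [dNu _]; apply: differentiable_continuous; exact/derivable1_diffP.
  split=> [u||].
  + by rewrite in_itv/= => /andP[xu _]; have [] := dN u (lt_trans bx xu).
  + by apply: cvg_at_right_filter; exact: cN.
  + by apply: cvg_at_left_filter; apply: cN; exact: lt_trans xy.
- move=> u; rewrite in_itv/= => /andP[xu _]; rewrite derive1E.
  exact: (@derive_val _ _ _ _ _ _ _ (dN u (lt_trans bx xu))).
Qed.

End Kernel.

Section WindowIntegral.
Variables (R : realType) (al s : R).
Hypotheses (al0 : 0 <= al) (s0 : 0 < s).
Implicit Types (e h t x y : R).
Local Notation K := (rate al s).
Local Notation Gam := (erate_int al s).
Local Notation G := (rate_int al s).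
Local Notation J := (rate_jump al s).

(** For [h >= 0] this is exactly finiteness of the integral: the closed window avoids the
    singularity at [e = 0], [t = 0]. *)
Definition regular e h := e != 0 \/ 2^-1 < h.

Lemma regular_le e h h' : h <= h' -> regular e h -> regular e h'.
Proof. by move=> hh' [e0|h2]; [left|right; exact: lt_le_trans hh']. Qed.

Lemma is_derive_affine (a b x : R) : is_derive x 1 (fun u => a + b * u) b.
Proof.
apply/is_derive1_caratheodory; exists (fun=> b); split=> //; last exact: cst_continuous.
by move=> z; ring.
Qed.

(** A single primitive, valid on a half-line that starts left of the window, serves all nearby [h],
    so that [G e] can be differentiated. *)
Lemma rate_int_primitive e h0 : regular e h0 -> exists b (N : R -> R), [/\ b < h0 - 2^-1,
  forall x, b < x -> is_derive x 1 N (K e x),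
  forall x, b < x -> {for x, continuous (K e)} &
  forall h, b < h - 2^-1 ->
    Gam e h = (G e h)%:E /\ G e h = N (h + 2^-1) - N (h - 2^-1)].
Proof.
move=> reg.
have [b bh rb] : exists2 b, b < h0 - 2^-1 & e != 0 \/ 0 < b.
  case: reg => [e0|h2]; first by exists (h0 - 2^-1 - 1); [lra|left].
  by exists ((h0 - 2^-1) / 2); [lra|right; lra].
have [N [dN iN]] := rate_primitive al s0 rb.
exists b, N; split=> // [x bx|h bh'].
  by apply: rate_continuous => //; case: rb => [|b0]; [left|right; rewrite gt_eqF// (lt_trans b0)].
have E : Gam e h = (N (h + 2^-1) - N (h - 2^-1))%:E by rewrite /erate_int iN//; lra.
by rewrite /rate_int E.
Qed.

Lemma erate_intE e h : regular e h -> Gam e h = (G e h)%:E.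
Proof. by move=> /rate_int_primitive[b [N [bh _ _ /(_ h bh)[]]]]. Qed.

Lemma rate_int_mean e h : regular e h -> exists2 x, h - 2^-1 < x < h + 2^-1 & G e h = K e x.
Proof.
move=> /rate_int_primitive[b [N [bh dN _ /(_ h bh)[_ ->]]]].
have hh : h - 2^-1 < h + 2^-1 by lra.
have [x||x xi ->] := @MVT _ N (K e) _ _ hh.
- by rewrite in_itv/= => /andP[hx _]; apply: dN; exact: lt_trans hx.
- apply: derivable_within_continuous => x; rewrite in_itv/= => /andP[hx _].
  by have [] := dN x (lt_le_trans bh hx).
- exists x; first by rewrite in_itv in xi.
  by rewrite (_ : _ - _ = 1) ?mulr1//; field.
Qed.

(** The mean value theorem is applied to the difference of the primitives: a common [x] reduces the
    comparison of two integrals to that of two rates at one time. *)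
Lemma rate_int_mean2 e e' h : regular e h -> regular e' h ->
  exists2 x, h - 2^-1 < x < h + 2^-1 & G e h - G e' h = K e x - K e' x.
Proof.
move=> /rate_int_primitive[b [N [bh dN _ /(_ h bh)[_ ->]]]].
move=> /rate_int_primitive[b' [N' [bh' dN' _ /(_ h bh')[_ ->]]]].
have hh : h - 2^-1 < h + 2^-1 by lra.
have dNN x : h - 2^-1 <= x -> is_derive x 1 (N - N') (K e x - K e' x).
  by move=> hx; apply: is_deriveB; [apply: dN|apply: dN']; apply: lt_le_trans hx.
have [x||x xi E] := @MVT _ (N - N') (fun x => K e x - K e' x) _ _ hh.
- by rewrite in_itv/= => /andP[hx _]; apply: dNN; exact: ltW.
- apply: derivable_within_continuous => x; rewrite in_itv/= => /andP[hx _].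
  by have [] := dNN x hx.
- exists x; first by rewrite in_itv in xi.
  move: E; rewrite !fctE => E.
  transitivity (N (h + 2^-1) - N' (h + 2^-1) - (N (h - 2^-1) - N' (h - 2^-1))); first by ring.
  by rewrite E (_ : _ - (h - _) = 1) ?mulr1//; field.
Qed.

Lemma rate_int_is_derive e h : regular e h -> is_derive h 1 (G e) (J e h).
Proof.
move=> /rate_int_primitive[b [N [bh dN _ GN]]].
apply: (@near_eq_is_derive _ _ _ ((N \o (fun u => 2^-1 + 1 * u)) - (N \o (fun u => - 2^-1 + 1 * u)))).
  near=> u; rewrite !fctE/= !mul1r.
  rewrite (GN u _).2; last by rewrite ltrBrDr; near: u; apply: lt_nbhsr; rewrite -ltrBrDr.
  by congr (N _ - N _); rewrite addrC.
apply: is_deriveB.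
  rewrite -[K e _]mulr1; apply: is_derive1_comp; last exact: is_derive_affine.
  by rewrite mul1r addrC; apply: dN; lra.
rewrite -[K e _]mulr1; apply: is_derive1_comp; last exact: is_derive_affine.
by rewrite mul1r addrC; apply: dN; lra.
Unshelve. all: by end_near. Qed.

Lemma rate_int_continuousr e h : regular e h -> {for h, continuous (G e)}.
Proof.
by move=> /rate_int_is_derive[dG _]; apply: differentiable_continuous; exact/derivable1_diffP.
Qed.

Lemma rate_jump_continuous e h : regular e h -> {for h, continuous (J e)}.
Proof.
move=> /rate_int_primitive[b [N [bh _ cN _]]].
have ck c : b < h + c -> {for h, continuous (fun u => K e (u + c))}.
  move=> bc; apply: (@continuous_comp _ _ _ (fun u => u + c) (K e)); last exact: cN.
  by apply: cvgD; [exact: cvg_id|exact: cvg_cst].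
apply: cvgB; first by apply: ck; lra.
by apply: ck.
Qed.

Lemma rate_int_meanr e h h' : regular e h -> h < h' ->
  exists2 x, h < x < h' & G e h' - G e h = J e x * (h' - h).
Proof.
move=> reg hh'.
have dG x : h <= x -> is_derive x 1 (G e) (J e x).
  by move=> hx; apply: rate_int_is_derive; exact: regular_le hx reg.
have [x||x xi E] := @MVT _ (G e) (J e) _ _ hh'.
- by rewrite in_itv/= => /andP[hx _]; apply: dG; exact: ltW.
- apply: derivable_within_continuous => x; rewrite in_itv/= => /andP[hx _].
  by have [] := dG x hx.
- by exists x => //; rewrite in_itv in xi.
Qed.

Lemma rate_int_riemann e h : regular e h ->
  n.+1%:R^-1 * \sum_(i < n.+1) K e (h - 2^-1 + i%:R / n.+1%:R) @[n --> \oo] --> G e h.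
Proof.
move=> /rate_int_primitive[b [N [bh dN cN /(_ h bh)[_ ->]]]].
have := @riemann01 R (fun u => K e (h - 2^-1 + u)) (fun u => N (h - 2^-1 + 1 * u)).
rewrite mulr1 mulr0 addr0 (_ : h - 2^-1 + 1 = h + 2^-1); last by field.
apply=> u /andP[u0 u1].
  apply: (@continuous_comp _ _ _ (fun u => h - 2^-1 + u) (K e)).
    by apply: cvgD; [exact: cvg_cst|exact: cvg_id].
  by apply: cN; lra.
rewrite -[K e _]mulr1; apply: is_derive1_comp; last exact: is_derive_affine.
by rewrite mul1r; apply: dN; lra.
Qed.

(** The increment of [G] in [h] is the integral of [J]. Analyticity in this direction thus comes
    from that of [J], a mere difference of two rates. *)
Lemma rate_int_riemannr e h y : regular e h -> regular e (h + y) ->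
  n.+1%:R^-1 * \sum_(i < n.+1) (y * J e (h + y * (i%:R / n.+1%:R))) @[n --> \oo]
    --> G e (h + y) - G e h.
Proof.
move=> reg regy.
have := @riemann01 R (fun u => y * J e (h + y * u)) (fun u => G e (h + y * u)).
rewrite mulr1 mulr0 addr0.
have ru u : 0 <= u <= 1 -> regular e (h + y * u).
  move=> /andP[u0 u1]; have [y0|y0] := leP 0 y.
    by apply: regular_le reg; rewrite lerDl mulr_ge0.
  by apply: regular_le regy; nra.
apply=> u /ru regu.
  apply: cvgMl_tmp; apply: (@continuous_comp _ _ _ (fun u => h + y * u) (J e)).
    by have [dA _] := is_derive_affine h y u; apply: differentiable_continuous; exact/derivable1_diffP.
  exact: rate_jump_continuous.
rewrite mulrC; apply: is_derive1_comp; last exact: is_derive_affine.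
exact: rate_int_is_derive.
Qed.

End WindowIntegral.

(** * Monotonicity, decay and blow-up of the window integral *)

Section Bounds.
Variables (R : realType) (al s : R).
Hypotheses (al0 : 0 <= al) (s0 : 0 < s).
Implicit Types (e h t x y : R).
Local Notation mu := (@lebesgue_measure R).
Local Notation K := (rate al s).
Local Notation Gam := (erate_int al s).
Local Notation G := (rate_int al s).
Local Notation J := (rate_jump al s).

Lemma regular_sumsq e h t : regular e h -> h - 2^-1 <= t -> 0 < e ^+ 2 + (s * t) ^+ 2.
Proof.
move=> reg ht; apply: sumsq_gt0 => //.
by case: reg => [|h2]; [left|right; rewrite gt_eqF//; lra].
Qed.

(** For [h > 0] the right end of the window is farther from [0] than the left one. *)
Lemma rate_jump_lt0 e h : regular e h -> 0 < h -> J e h < 0.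
Proof.
move=> reg h0; rewrite subr_lt0; apply: rate_lt => //; last exact: (@regular_sumsq _ h).
rewrite ltrD2l !exprMn ltr_pM2l ?exprn_gt0//; nra.
Qed.

Lemma rate_int_decrr e h h' : regular e h -> 0 <= h -> h < h' -> G e h' < G e h.
Proof.
move=> reg h0 hh'; have [x /andP[hx xh] E] := rate_int_meanr al s0 reg hh'.
rewrite -subr_lt0 E nmulr_rlt0 ?subr_gt0// rate_jump_lt0//; last exact: le_lt_trans hx.
by apply: regular_le reg; exact: ltW.
Qed.

Lemma rate_int_injr e h h' : regular e h -> regular e h' -> 0 <= h -> 0 <= h' ->
  G e h = G e h' -> h = h'.
Proof.
move=> r r' h0 h'0 E; have [lt|lt|//] := ltgtP h h'.
  by have := rate_int_decrr r h0 lt; rewrite E ltxx.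
by have := rate_int_decrr r' h'0 lt; rewrite E ltxx.
Qed.

Lemma rate_int_decrl e e' h : regular e h -> `|e| < `|e'| -> G e' h < G e h.
Proof.
move=> reg ee'; have reg' : regular e' h.
  by left; rewrite -normr_gt0 (le_lt_trans _ ee').
have [x /andP[hx _] E] := rate_int_mean2 al s0 reg reg'.
rewrite -subr_gt0 E subr_gt0; apply: rate_lt => //; last exact: (regular_sumsq reg (ltW hx)).
by rewrite ltrD2r -(real_normK (num_real e)) -(real_normK (num_real e')) ltrXn2r ?nnegrE.
Qed.

Lemma rate_int_gt0 e h : regular e h -> 0 < G e h.
Proof.
move=> reg; have [x /andP[hx _] ->] := rate_int_mean al s0 reg.
by rewrite divr_gt0 ?expR_gt0// (regular_sumsq reg (ltW hx)).
Qed.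

Lemma rate_int_decayr e h : 2^-1 < h -> G e h <= ((s * (h - 2^-1)) ^+ 2)^-1.
Proof.
move=> h2; have [x /andP[hx _] ->] := rate_int_mean al s0 (or_intror h2 : regular e h).
apply: (le_trans (rate_le_inv _ _ _ _)) => //.
have sh : 0 < s * (h - 2^-1) by rewrite mulr_gt0//; lra.
rewrite lef_pV2 ?posrE ?exprn_gt0//.
  by rewrite ler_wpDl ?sqr_ge0// lerXn2r ?nnegrE ?mulr_ge0 ?(ltW s0)// ?ler_pM2l//; lra.
by rewrite ltr_wpDl ?sqr_ge0// exprn_gt0// (lt_trans sh)// ltr_pM2l.
Qed.

Lemma rate_int_decayl e h : e != 0 -> G e h <= (e ^+ 2)^-1.
Proof.
move=> e0; have [x _ ->] := rate_int_mean al s0 (or_introl e0 : regular e h).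
apply: (le_trans (rate_le_inv _ _ _ _)) => //.
have e2 : 0 < e ^+ 2 by rewrite exprn_even_gt0.
by rewrite lef_pV2 ?posrE ?ltr_pwDl ?sqr_ge0// lerDl sqr_ge0.
Qed.

Lemma erate_int_normr e h : Gam `|e| h = Gam e h.
Proof. by rewrite /erate_int; under eq_integral do rewrite rate_normr. Qed.

Lemma measurable_rate2 : measurable_fun [set: R * R] (fun p => K p.1 p.2).
Proof.
have mq : measurable_fun [set: R * R] (fun p => p.1 ^+ 2 + (s * p.2) ^+ 2).
  apply: measurable_funD; apply: measurable_funX => //.
  by apply: measurable_funM => //.
rewrite (_ : (fun p => _) = (fun p : R * R =>
    expR (- al * Num.sqrt (p.1 ^+ 2 + (s * p.2) ^+ 2)) * powR (p.1 ^+ 2 + (s * p.2) ^+ 2) (-1))).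
  apply: measurable_funM.
    apply: measurableT_comp; first exact: measurable_expR.
    apply: measurable_funM; first exact: measurable_cst.
    exact: (measurableT_comp (continuous_measurable_fun (@sqrt_continuous R)) mq).
  exact: (measurableT_comp (@measurable_powR R (-1)) mq).
by apply/funext => p; rewrite powR_inv1// addr_ge0 ?sqr_ge0.
Qed.

Lemma measurable_rate e : measurable_fun [set: R] (K e).
Proof. exact: (measurableT_comp measurable_rate2 (measurable_pair1 e)). Qed.

(** The window contains [[d, 2 d]], as [h - 2^-1 <= d] and [2 d <= 2^-1]. There the rate is at least
    [B / d ^+ 2], so the integral is at least [B / d]. *)
Lemma erate_int_blowup (M : R) : exists2 d, 0 < d <= 4^-1 &
  forall e h, 0 <= h -> h <= 2^-1 + d -> `|e| <= d -> (M%:E < Gam e h)%E.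
Proof.
pose B : R := expR (- al * Num.sqrt (1 + (2 * s) ^+ 2)) / (1 + (2 * s) ^+ 2).
have q0 : 0 < 1 + (2 * s) ^+ 2 by rewrite ltr_pwDl ?sqr_ge0.
have B0 : 0 < B by rewrite divr_gt0 ?expR_gt0.
pose d := Num.min 4^-1 (B / (`|M| + 1)).
have M1 : 0 < `|M| + 1 by rewrite ltr_wpDl.
have d0 : 0 < d by rewrite lt_min invr_gt0 ltr0n/= divr_gt0.
have d4 : d <= 4^-1 by rewrite /d ge_min lexx.
exists d; first by rewrite d0.
move=> e h h0 hd ed.
have Bd : M < B / d.
  rewrite ltr_pdivlMr//; apply: (@lt_le_trans _ _ ((`|M| + 1) * d)).
    by rewrite ltr_pM2r// (le_lt_trans (ler_norm _))// ltrDl.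
  rewrite mulrC -ler_pdivlMr//; first by rewrite /d ge_min lexx orbT.
have kB t : d <= t <= 2 * d -> B / (d ^+ 2) <= K e t.
  move=> /andP[dt td].
  have qle : e ^+ 2 + (s * t) ^+ 2 <= d ^+ 2 * (1 + (2 * s) ^+ 2).
    rewrite mulrDr mulr1 -exprMn (_ : d * (2 * s) = s * (2 * d)); last by ring.
    apply: lerD.
      by rewrite -(real_normK (num_real e)) lerXn2r ?nnegrE ?(ltW d0).
    rewrite lerXn2r ?nnegrE ?mulr_ge0 ?(ltW s0) ?(ltW d0)//; first by rewrite (le_trans _ dt)// ltW.
    by rewrite ler_pM2l.
  have t0 : t != 0 by rewrite gt_eqF// (lt_le_trans d0).
  have qt0 : 0 < e ^+ 2 + (s * t) ^+ 2 by apply: sumsq_gt0 => //; right.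
  rewrite /B -mulrA -invfM; apply: ler_pM; rewrite ?expR_ge0 ?invr_ge0 ?mulr_ge0 ?sqr_ge0 ?(ltW q0) ?(ltW d0)//.
    rewrite ler_expR !mulNr lerN2 ler_wpM2l// ler_wsqrtr// (le_trans qle)//.
    by rewrite ler_piMl ?(ltW q0)// expr_le1// ?(ltW d0)//; lra.
  by rewrite lef_pV2 ?posrE ?mulr_gt0 ?exprn_gt0// [leRHS]mulrC.
apply: (@lt_le_trans _ _ (\int[mu]_(t in `[d, (2 * d)%R]) (cst (B / d ^+ 2)%:E t))%E).
  rewrite integral_cst//= lebesgue_measure_itv/= lte_fin ifT; last by lra.
  rewrite -EFinD -EFinM lte_fin (_ : B / d ^+ 2 * (2 * d - d) = B / d)//.
  by field; rewrite gt_eqF.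
apply: (@le_trans _ _ (\int[mu]_(t in `[d, (2 * d)%R]) (K e t)%:E)%E).
  apply: ge0_le_integral => //=.
  - by move=> t _; rewrite lee_fin divr_ge0 ?sqr_ge0// ltW.
  - by apply/measurable_EFinP; apply: measurable_funTS; exact: measurable_rate.
apply: ge0_subset_integral => //=.
- by apply/measurable_EFinP; apply: measurable_funTS; exact: measurable_rate.
- by move=> t _; rewrite lee_fin rate_ge0.
- by move=> t; rewrite /= !in_itv/= => /andP[dt td]; apply/andP; split; lra.
Qed.

Lemma erate_int0_pinfty h : 0 <= h <= 2^-1 -> Gam 0 h = +oo%E.
Proof.
move=> /andP[h0 h2].
have H (M : R) : (M%:E < Gam 0 h)%E.
  by have [d /andP[d0 _]] := erate_int_blowup M; apply=> //; rewrite ?normr0; lra.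
case E : (Gam 0 h) => [v|//|].
  by have := H v; rewrite E ltxx.
by have := H 0; rewrite E.
Qed.

Lemma erate_int_fin_regular e h c : 0 <= h -> Gam e h = c%:E -> regular e h /\ G e h = c.
Proof.
move=> h0 E; split; last by rewrite /rate_int E.
have [e0|] := eqVneq e 0; last by left.
right; rewrite ltNge; apply/negP => h2.
by move: E; rewrite e0 erate_int0_pinfty// h0.
Qed.

Lemma rate_int_blowup (M : R) : exists2 d, 0 < d <= 4^-1 &
  forall e h, regular e h -> 0 <= h -> h <= 2^-1 + d -> `|e| <= d -> M < G e h.
Proof.
have [d d0 H] := erate_int_blowup M; exists d => // e h reg h0 hd ed.
by have := H e h h0 hd ed; rewrite (erate_intE al s0 reg) lte_fin.
Qed.

End Bounds.

(** * Analyticity of the window integral *)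

Section LevelCurve.
Variables (R : realType) (al s : R).
Hypotheses (al0 : 0 <= al) (s0 : 0 < s).
Implicit Types (e h t x y r c : R).
Local Notation K := (rate al s).
Local Notation G := (rate_int al s).
Local Notation J := (rate_jump al s).

Lemma ana_sumsq r e0 t0 L d (E T : R -> R) :
  `|e0| <= L -> `|t0| <= L -> ana r d E -> ana r d T -> d <= 1 ->
  ana r ((1 + s ^+ 2) * (2 * L + 1) * d) (fun x =>
    ((e0 + E x) ^+ 2 + (s * (t0 + T x)) ^+ 2) - (e0 ^+ 2 + (s * t0) ^+ 2)).
Proof.
move=> eL tL aE aT d1; have d0 := ana_ge0 aE.
have H u v (U : R -> R) : `|u| <= L -> ana r d U ->
    ana r (`|v| * ((2 * L + 1) * d)) (fun x => v * (2 * u * U x + U x * U x)).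
  move=> uL aU; apply: ana_scale.
  apply: ana_le (ana_add (ana_scale (2 * u) aU) (ana_mul aU aU)).
  rewrite [leRHS](_ : _ = 2 * L * d + d); last by ring.
  apply: lerD; last by rewrite ler_piMr.
  by rewrite ler_wpM2r// normrM ger0_norm// ler_pM2l.
have := ana_add (H _ 1 _ eL aE) (H _ (s ^+ 2) _ tL aT).
rewrite normr1 ger0_norm ?sqr_ge0// -mulrDl mulrA.
by apply: eq_ana => x _; ring.
Qed.

(** [C] and [d0] depend on the base point only through [eta] and [L]: one constant then bounds every
    term of a Riemann sum over the window. The proof factors the rate as
    [K e0 t0 * (1 + u) * (1 + v)], where [u] comes from the exponential and [v] from the inverse
    square. *)
Lemma rate_ana (eta L : R) : 0 < eta -> 0 <= L -> exists C d0, [/\ 0 <= C, 0 < d0 &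
  forall r d e0 t0 (E T : R -> R), eta <= e0 ^+ 2 + (s * t0) ^+ 2 ->
    `|e0| <= L -> `|t0| <= L -> ana r d E -> ana r d T -> d <= d0 ->
    ana r (C * d) (fun x => K (e0 + E x) (t0 + T x) - K e0 t0)].
Proof.
move=> eta0 L0; pose C1 := (1 + s ^+ 2) * (2 * L + 1).
have C10 : 0 < C1 by apply: mulr_gt0; [rewrite ltr_pwDl ?sqr_ge0|lra].
pose B := al * Num.sqrt (L ^+ 2 + (s * L) ^+ 2).
have B0 : 0 <= B by rewrite mulr_ge0// sqrtr_ge0.
(* [C1 / eta * d] bounds the relative variation [z] of the squared distance. The bound on [d] makes
   it at most [(2 + B)^-1], so that [|z| <= 2^-1] and the exponent [- k * w] is bounded by [1]. The
   factor [6 * B + 2] accounts for [u + v + u * v], and [eta^-1] bounds [K e0 t0]. *)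
exists ((6 * B + 2) * (C1 / eta) / eta), (Num.min 1 (eta / (C1 * (2 + B)))); split.
- have C1e : 0 <= C1 / eta by rewrite divr_ge0// ltW.
  by apply: divr_ge0; [apply: mulr_ge0 => //; lra|exact: ltW].
- by rewrite lt_min ltr01 divr_gt0// mulr_gt0//; lra.
move=> r d e0 t0 E T q0eta eL tL aE aT; rewrite le_min => /andP[d1 dd].
have r0 := ana_gt0 aE; have d0 := ana_ge0 aE.
set q0 := e0 ^+ 2 + (s * t0) ^+ 2 in q0eta *.
have q00 : 0 < q0 by exact: lt_le_trans q0eta.
pose z (x : R) := q0^-1 * ((e0 + E x) ^+ 2 + (s * (t0 + T x)) ^+ 2 - q0).
pose ze := C1 / eta * d.
have ze0 : 0 <= ze by rewrite mulr_ge0// divr_ge0// ltW.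
have zeB : ze * (2 + B) <= 1.
  move: dd; rewrite ler_pdivlMr; last by rewrite mulr_gt0//; lra.
  move=> dd; rewrite /ze (_ : _ * _ * _ = d * (C1 * (2 + B)) / eta); last by ring.
  by rewrite ler_pdivrMr// mul1r.
have az : ana r ze z.
  apply: ana_le (ana_scale q0^-1 (ana_sumsq eL tL aE aT d1)).
  rewrite gtr0_norm ?invr_gt0// mulrA mulrC -/C1 /ze mulrC ler_wpM2r//.
  by rewrite mulrC ler_pM2l// lef_pV2.
have ze2 : ze <= 2^-1 by nra.
have zeB1 : B * ze <= 1 by nra.
have zx x : `|x| < r -> `|z x| <= 2^-1 by move=> xr; exact: le_trans (ana_bound az xr) ze2.
have qE x : (e0 + E x) ^+ 2 + (s * (t0 + T x)) ^+ 2 = q0 * (1 + z x).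
  by rewrite /z; field; rewrite gt_eqF.
pose w (x : R) := Num.sqrt (1 + z x) - 1.
have aw : ana r ze w by exact: ana_sqrt1D.
pose k := al * Num.sqrt q0.
have k0 : 0 <= k by rewrite mulr_ge0// sqrtr_ge0.
have kB : k <= B.
  rewrite ler_wpM2l// ler_wsqrtr// lerD//.
    by rewrite -(real_normK (num_real e0)) lerXn2r ?nnegrE.
  rewrite !exprMn ler_wpM2l ?sqr_ge0// -(real_normK (num_real t0)) lerXn2r ?nnegrE//.
pose u (x : R) := expR (- k * w x) - 1.
have au : ana r (2 * (B * ze)) u.
  apply: ana_expR => //; apply: ana_le (ana_scale (- k) aw).
  by rewrite normrN ger0_norm// ler_wpM2r.
pose v (x : R) := (1 + z x)^-1 - 1.
have av : ana r (2 * ze) v by exact: ana_inv1D.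
have K0 : `|K e0 t0| <= eta^-1.
  rewrite ger0_norm ?rate_ge0//; apply: (le_trans (rate_le_inv _ _ _ _)) => //.
  by rewrite lef_pV2.
apply: (@eq_ana _ _ _ (fun x => K e0 t0 * (u x + v x + u x * v x))) => [x xr|].
  have z1 : 0 < 1 + z x by have := zx x xr; rewrite ler_norml => /andP[? ?]; lra.
  rewrite /rate qE sqrtrM ?(ltW q00)// -/q0.
  rewrite (_ : - al * (Num.sqrt q0 * Num.sqrt (1 + z x)) = - al * Num.sqrt q0 + - k * w x).
    rewrite expRD /u /v; field; rewrite !gt_eqF//.
  by rewrite /k /w; ring.
have Bz : 0 <= B * ze by exact: mulr_ge0.
apply: ana_le (ana_scale (K e0 t0) (ana_add (ana_add au av) (ana_mul au av))).
apply: (@le_trans _ _ (eta^-1 * (2 * (B * ze) + 2 * ze + 2 * (B * ze) * (2 * ze)))).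
  by rewrite ler_wpM2r//; nra.
rewrite (_ : _ * d = eta^-1 * ((6 * B + 2) * ze)); last by rewrite /ze; ring.
rewrite ler_wpM2l ?invr_ge0 ?(ltW eta0)//.
nra.
Qed.

Lemma ana_mean r M (F : nat -> R -> R) n : 0 < r ->
  (forall i, (i < n.+1)%N -> ana r M (F i)) ->
  ana r M (fun x => n.+1%:R^-1 * \sum_(i < n.+1) F i x).
Proof.
move=> r0 aF; have := ana_scale n.+1%:R^-1 (@ana_sum _ r (fun=> M) F n.+1 r0 aF).
apply: ana_le; rewrite sumr_const card_ord -[M *+ _]mulr_natl mulrA.
by rewrite ger0_norm ?invr_ge0 ?ler0n// mulVf ?mul1r// pnatr_eq0.
Qed.

Lemma regular_near e0 h0 : regular e0 h0 -> exists2 m, 0 < m &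
  forall e h, `|e| < m -> `|h| < m -> regular (e0 + e) (h0 + h).
Proof.
case=> [e00|h02].
  exists `|e0|; first by rewrite normr_gt0.
  move=> e h em _; left; apply: contraTneq em => e0e.
  by rewrite -leNgt (_ : e = - e0) ?normrN//; lra.
exists (h0 - 2^-1); first by rewrite subr_gt0.
by move=> e h _; rewrite ltr_norml => /andP[hm _]; right; lra.
Qed.

Lemma regular_window e0 h0 : regular e0 h0 -> exists eta L, [/\ 0 < eta, 0 <= L, `|e0| <= L &
  forall t, h0 - 2^-1 <= t <= h0 + 2^-1 -> eta <= e0 ^+ 2 + (s * t) ^+ 2 /\ `|t| <= L].
Proof.
move=> reg; exists (if e0 == 0 then (s * (h0 - 2^-1)) ^+ 2 else e0 ^+ 2), (`|e0| + `|h0| + 1).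
have tL t : h0 - 2^-1 <= t <= h0 + 2^-1 -> `|t| <= `|e0| + `|h0| + 1.
  move=> /andP[h1 h2]; have n0 := normr_ge0 e0; have := ler_norm h0.
  have := ler_norm (- h0); rewrite normrN => ? ?.
  by rewrite ler_norml; apply/andP; split; lra.
have L0 : 0 <= `|e0| + `|h0| + 1 by rewrite !addr_ge0.
have eL : `|e0| <= `|e0| + `|h0| + 1 by rewrite -addrA lerDl addr_ge0.
case: eqP reg => [e00|/eqP e00] reg; split=> // [|t ht].
- by case: reg => [/eqP//|h2]; rewrite exprn_gt0// mulr_gt0//; lra.
- split; last exact: tL.
  case: reg => [/eqP//|h2]; move: ht => /andP[ht _].
  by rewrite e00 expr0n/= add0r lerXn2r ?nnegrE ?mulr_ge0 ?ler_pM2l ?(ltW s0)//; lra.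
- by rewrite exprn_even_gt0.
- by split; [rewrite lerDl sqr_ge0|exact: tL].
Qed.

(** The Riemann sums of the difference satisfy the bound of [rate_ana], uniformly over the window,
    and [ana_cvg] keeps it in the limit. *)
Lemma rate_int_ana e0 h : regular e0 h -> exists C d0, [/\ 0 <= C, 0 < d0 &
  forall r d (E : R -> R), ana r d E -> d <= d0 ->
    ana r (C * d) (fun x => G (e0 + E x) h - G e0 h)].
Proof.
move=> reg; have [eta [L [eta0 L0 eL win]]] := regular_window reg.
have [m m0 regm] := regular_near reg.
have [C [d0 [C0 d00 kA]]] := rate_ana eta0 L0.
exists C, (Num.min d0 (m / 2)); split=> //; first by rewrite lt_min d00 divr_gt0.
move=> r d E aE; rewrite le_min => /andP[dd0 dm].
have r0 := ana_gt0 aE; have dge0 := ana_ge0 aE.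
pose t n i : R := h - 2^-1 + i%:R / n.+1%:R.
apply: (@ana_cvg _ _ _ (fun n x => n.+1%:R^-1 * \sum_(i < n.+1)
  (K (e0 + E x) (t n i) - K e0 (t n i)))) => [n|x xr].
  apply: (@ana_mean r _ (fun i x => K (e0 + E x) (t n i) - K e0 (t n i))) => // i ni.
  have ht : h - 2^-1 <= t n i <= h + 2^-1.
    have i0 : 0 <= i%:R / n.+1%:R :> R by rewrite divr_ge0.
    have i1 : i%:R / n.+1%:R <= 1 :> R by rewrite ler_pdivrMr// mul1r ler_nat ltnW.
    by rewrite /t; move: (_ / _) i0 i1 => u u0 u1; apply/andP; split; lra.
  have [q0 tL] := win _ ht.
  have a0 : ana r d (fun=> 0) by apply: ana_le dge0 _; have := ana_cst 0 r0; rewrite normr0.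
  by apply: eq_ana (kA _ _ _ _ _ _ q0 eL tL aE a0 dd0) => x _; rewrite addr0.
under eq_fun do rewrite sumrB mulrBr.
apply: cvgB; last exact: rate_int_riemann.
apply: rate_int_riemann => //.
have := regm (E x) 0; rewrite addr0 normr0; apply=> //.
by apply: le_lt_trans (ana_bound aE xr) _; lra.
Qed.

Lemma rate_jump_ana e0 h : regular e0 h -> exists C d0, [/\ 0 <= C, 0 < d0 &
  forall r d (E Y : R -> R), ana r d E -> ana r d Y -> d <= d0 ->
    ana r (C * d) (fun x => J (e0 + E x) (h + Y x) - J e0 h)].
Proof.
move=> reg; have [eta [L [eta0 L0 eL win]]] := regular_window reg.
have [C [d0 [C0 d00 kA]]] := rate_ana eta0 L0.
exists (C + C), d0; split=> //; first by rewrite addr_ge0.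
move=> r d E Y aE aY dd0.
have [q1 tL1] : _ /\ _ := win (h + 2^-1) ltac:(apply/andP; split; lra).
have [q2 tL2] : _ /\ _ := win (h - 2^-1) ltac:(apply/andP; split; lra).
rewrite mulrDl.
have := ana_sub (kA _ _ _ _ _ _ q1 eL tL1 aE aY dd0) (kA _ _ _ _ _ _ q2 eL tL2 aE aY dd0).
apply: eq_ana => x _; rewrite /rate_jump [h + Y x + _]addrAC [h + Y x - _]addrAC; ring.
Qed.

End LevelCurve.

(** * Level curves of the window integral *)

Section ImplicitFunction.
Variables (R : realType) (al s : R).
Hypotheses (al0 : 0 <= al) (s0 : 0 < s).
Implicit Types (e h t x y r c : R).
Local Notation G := (rate_int al s).
Local Notation J := (rate_jump al s).

(* Implicit function theorem: the root y of G (a0 + x) (h0 + y) = c is the fixed point of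
   y |-> y - (G (a0 + x) (h0 + y) - c) / J a0 h0, where J is the partial derivative of G in h. *)
Lemma level_analytic a0 h0 c : regular a0 h0 -> 0 < h0 -> G a0 h0 = c ->
  exists r M phi, ana r M phi /\ forall x, `|x| < r ->
    [/\ 0 < h0 + phi x, regular (a0 + x) (h0 + phi x) & G (a0 + x) (h0 + phi x) = c].
Proof.
move=> reg h00 Gc.
have [m1 m10 regm] := regular_near reg.
have [CG [dG [CG0 dG0 GA]]] := rate_int_ana al0 s0 reg.
have [CJ [dJ [CJ0 dJ0 JA]]] := rate_jump_ana al0 s0 reg.
have J0 : J a0 h0 < 0 by exact: rate_jump_lt0.
pose k := - (J a0 h0)^-1.
have k0 : 0 < k by rewrite oppr_gt0 invr_lt0.
(* The first two bounds keep the points regular and [h0 + y] positive, and [dJ] is the range of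
   [JA]. The last one gives [k * (CJ * m) <= 2^-1], which makes the iteration a contraction. *)
pose m := Num.min (Num.min (m1 / 2) (h0 / 2)) (Num.min dJ ((2 * (k * CJ + 1))^-1)).
have kC : 0 < 2 * (k * CJ + 1) by rewrite mulr_gt0// ltr_wpDl// mulr_ge0// ltW.
have m0 : 0 < m by rewrite !lt_min !divr_gt0// dJ0 invr_gt0.
have mm1 : m < m1.
  by apply: (@le_lt_trans _ _ (m1 / 2)); [rewrite /m !ge_min lexx|lra].
have mh : m < h0.
  by apply: (@le_lt_trans _ _ (h0 / 2)); [rewrite /m !ge_min lexx orbT|lra].
have mJ : m <= dJ by rewrite /m !ge_min lexx !orbT.
have mC : k * (CJ * m) <= 2^-1.
  have : m <= (2 * (k * CJ + 1))^-1 by rewrite /m !ge_min lexx !orbT.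
  rewrite -div1r ler_pdivlMr// => H.
  by rewrite mulrA; have : 0 <= k * CJ by [rewrite mulr_ge0// ltW]; nra.
clearbody m.
(* [r] is chosen after [m] so that moving [x] alone shifts the iterate by at most [m / 2]; the other
   half is left to the variation of [J]. *)
pose r := Num.min m (Num.min dG (m * (2 * (k * CG + 1))^-1)).
have kG : 0 < 2 * (k * CG + 1) by rewrite mulr_gt0// ltr_wpDl// mulr_ge0// ltW.
have r0 : 0 < r by rewrite !lt_min m0 dG0 mulr_gt0// invr_gt0.
have rm : r <= m by rewrite /r !ge_min lexx.
have rG : r <= dG by rewrite /r !ge_min lexx !orbT.
have rC : k * (CG * r) <= m / 2.
  have : r <= m * (2 * (k * CG + 1))^-1 by rewrite /r !ge_min lexx !orbT.
  rewrite ler_pdivlMr// => H.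
  by rewrite mulrA; have : 0 <= k * CG by [rewrite mulr_ge0// ltW]; nra.
have aid : ana r m (fun x => x) by apply: ana_le rm _; exact: ana_id.
have regx x y : `|x| < r -> `|y| <= m -> regular (a0 + x) (h0 + y).
  by move=> xr ym; apply: regm; lra.
have hy0 y : `|y| <= m -> 0 < h0 + y by rewrite ler_norml => /andP[? ?]; lra.
clearbody r.
pose T x y := y + k * (G (a0 + x) (h0 + y) - c).
have TM g : ana r m g -> ana r m (fun x => T x (g x)).
  move=> ag.
  (* As [k * J a0 h0 = -1], the linear term in [y] cancels: there remain the variation of [G] in [x]
     at height [h0] and the integral of [J - J a0 h0]. *)
  apply: (@ana_cvg _ _ _ (fun n x => k * (G (a0 + x) h0 - G a0 h0) +
    k * (n.+1%:R^-1 * \sum_(i < n.+1)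
      (g x * (J (a0 + x) (h0 + g x * (i%:R / n.+1%:R)) - J a0 h0))))) => [n|x xr]; last first.
    rewrite /T (_ : g x + _ = k * (G (a0 + x) h0 - G a0 h0) +
      k * (G (a0 + x) (h0 + g x) - G (a0 + x) h0 - g x * J a0 h0)); last first.
      by rewrite -Gc /k; field; rewrite lt_eqF.
    apply: cvgD; first exact: cvg_cst.
    apply: cvgMl_tmp.
    have E n : n.+1%:R^-1 * \sum_(i < n.+1)
        (g x * (J (a0 + x) (h0 + g x * (i%:R / n.+1%:R)) - J a0 h0)) =
      n.+1%:R^-1 * \sum_(i < n.+1) (g x * J (a0 + x) (h0 + g x * (i%:R / n.+1%:R))) -
      g x * J a0 h0.
      under eq_bigr do rewrite mulrBr.
      rewrite sumrB mulrBr; congr (_ - _).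
      by rewrite sumr_const card_ord -[X in _ * X = _]mulr_natl mulKf// pnatr_eq0.
    under eq_fun do rewrite E.
    apply: cvgB; last exact: cvg_cst.
    apply: rate_int_riemannr => //.
      by have := regx x 0 xr; rewrite addr0; apply; rewrite normr0 ltW.
    by apply: regx => //; exact: ana_bound ag xr.
  have mhalf : m = m / 2 + m / 2 by field.
  rewrite [in X in ana r X]mhalf; apply: ana_add.
    apply: ana_le (ana_scale k (GA r r (fun x => x) (ana_id r0) rG)).
    by rewrite gtr0_norm.
  apply: (@ana_le _ _ (`|k| * (m * (CJ * m)))).
    by rewrite gtr0_norm//; nra.
  apply: ana_scale.
  apply: (@ana_mean _ r _ (fun i x => g x * (J (a0 + x) (h0 + g x * (i%:R / n.+1%:R)) - J a0 h0))).
    by [].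
  move=> i ni; apply: ana_mul => //.
  apply: (JA r m (fun x => x) (fun x => g x * (i%:R / n.+1%:R))) => //.
  apply: (@eq_ana _ _ _ (fun x => i%:R / n.+1%:R * g x)) => [x _|]; first by rewrite mulrC.
  apply: ana_le (ana_scale _ ag); rewrite ger0_norm ?divr_ge0// ler_piMl ?(ltW m0)//.
  by rewrite ler_pdivrMr// mul1r ler_nat ltnW.
have acst y : `|y| <= m -> ana r m (fun=> y).
  by move=> ym; apply: ana_le ym _; exact: ana_cst.
have Tm x y : `|x| < r -> `|y| <= m -> `|T x y| <= m.
  by move=> xr ym; exact: (ana_bound (TM _ (acst y ym)) xr).
have Jx x y : `|x| < r -> `|y| <= m -> `|1 + k * J (a0 + x) (h0 + y)| <= 2^-1.
  move=> xr ym; have := ana_bound (JA r m _ _ aid (acst y ym) mJ) xr => Jb.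
  rewrite (_ : 1 + _ = k * (J (a0 + x) (h0 + y) - J a0 h0)); last first.
    by rewrite /k; field; rewrite lt_eqF.
  by rewrite normrM gtr0_norm// (le_trans _ mC)// ler_pM2l.
have Tlt x y y' : `|x| < r -> `|y| <= m -> `|y'| <= m -> y < y' ->
    `|T x y' - T x y| <= 2^-1 * `|y' - y|.
  move=> xr ym y'm yy'.
  have lt : h0 + y < h0 + y' by rewrite ltrD2l.
  have [u /andP[uy uy'] E] := rate_int_meanr al s0 (regx x y xr ym) lt.
  rewrite (_ : _ - _ = (1 + k * J (a0 + x) (h0 + (u - h0))) * (y' - y)).
    rewrite normrM ler_wpM2r// Jx//; move: ym y'm; rewrite !ler_norml => /andP[? ?] /andP[? ?].
    by apply/andP; split; lra.
  rewrite /T [h0 + (u - h0)]addrC subrK.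
  rewrite (_ : y' + _ - _ = (y' - y) + k * (G (a0 + x) (h0 + y') - G (a0 + x) (h0 + y))); last by ring.
  by rewrite E; ring.
have Tc x y y' : `|x| < r -> `|y| <= m -> `|y'| <= m -> `|T x y' - T x y| <= 2^-1 * `|y' - y|.
  move=> xr ym y'm; have [lt|lt|->] := ltgtP y y'; first exact: Tlt.
    by rewrite distrC (distrC y'); exact: Tlt.
  by rewrite !subrr normr0 mulr0.
(* [ana_picard] takes its limit as given: the fixed point is first found for each [x] by the
   intermediate value theorem. *)
have fixp x : exists y, `|x| < r -> `|y| <= m /\ T x y = y.
  have [xr|xr] := ltP `|x| r; last by exists 0.
  have cT : {within `[- m, m], continuous (fun y => G (a0 + x) (h0 + y))}.
    apply: continuous_in_subspaceT => y /[!inE]/=; rewrite in_itv/= => ym.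
    apply: (@continuous_comp _ _ _ (fun y => h0 + y) (G (a0 + x))).
      by apply: cvgD; [exact: cvg_cst|exact: cvg_id].
    by apply: rate_int_continuousr => //; apply: regx => //; rewrite ler_norml.
  have mm : - m <= m by lra.
  have nm : `|- m| <= m by rewrite normrN gtr0_norm.
  have pm : `|m| <= m by rewrite gtr0_norm.
  have h1 : c <= G (a0 + x) (h0 + - m).
    have := Tm x (- m) xr nm; rewrite ler_norml /T => /andP[+ _].
    by rewrite lerDl pmulr_rge0// subr_ge0.
  have h2 : G (a0 + x) (h0 + m) <= c.
    have := Tm x m xr pm; rewrite ler_norml /T => /andP[_].
    by rewrite gerDl pmulr_rle0// subr_le0.
  have [|y ym Ey] := @IVT _ _ _ _ c mm cT.
    by rewrite ge_min le_max h1 h2 orbT.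
  exists y => _; split; first by rewrite ler_norml; rewrite in_itv in ym.
  by rewrite /T Ey subrr mulr0 addr0.
have [phi phiP] := choice fixp.
exists r, m, phi; split.
  apply: (@ana_picard _ r m (fun g x => T x (g x))) => //; first exact: ltW.
  move=> g x ag xr; have [pm pT] := phiP x xr.
  by rewrite -{1}pT; apply: Tc => //; exact: ana_bound ag xr.
move=> x xr; have [pm pT] := phiP x xr; split; [exact: hy0|exact: regx|].
move: pT; rewrite /T => /eqP; rewrite -subr_eq0 addrAC subrr add0r mulf_eq0 gt_eqF//=.
by rewrite subr_eq0 => /eqP.
Qed.

End ImplicitFunction.

Lemma countable_setU T (A B : set T) : countable A -> countable B -> countable (A `|` B).
Proof.
move=> cA cB; rewrite (_ : A `|` B = \bigcup_(b in [set: bool]) (if b then A else B)).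
  by apply: bigcup_countable => [|[]]; first exact: countableP.
apply/seteqP; split=> [x [Ax|Bx]|x [[] _]]; [by exists true|by exists false|by left|by right].
Qed.

(** * Translations that equalise the window integrals of two sensors *)

Section ZeroSets.
Variables (R : realType) (al s : R).
Hypotheses (al0 : 0 <= al) (s0 : 0 < s).
Implicit Types (a e h t x y r c d : R).
Local Notation G := (rate_int al s).

Lemma rate_int_normr e h : G `|e| h = G e h.
Proof. by rewrite /rate_int erate_int_normr. Qed.

Lemma rate_int_analytic (b a x : R) h : `|b| = 1 -> regular (a + b * x) h ->
  analytic_at (fun u => G (a + b * u) h) x.
Proof.
move=> b1 reg; have [C [d0 [C0 d00 GA]]] := rate_int_ana al0 s0 reg.
have ab : ana d0 d0 (fun u => b * u).
  by have := ana_scale b (ana_id d00); rewrite b1 mul1r.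
exists d0, (C * d0 + `|G (a + b * x) h|).
apply: eq_ana (ana_add (GA _ _ _ ab (lexx _)) (ana_cst (G (a + b * x) h) d00)) => u _.
by rewrite subrK mulrDr addrA.
Qed.

Lemma rate_int_continuousl e h : regular e h -> {for e, continuous (G^~ h)}.
Proof.
move=> reg; have := @rate_int_analytic 1 0 e h (normr1 _).
rewrite add0r mul1r => /(_ reg) /analytic_at_continuous.
by rewrite (_ : (fun u => _) = G^~ h)//; apply/funext => u; rewrite add0r mul1r.
Qed.

Let D a1 h1 a2 h2 d := G (a1 - d) h1 - G (a2 - d) h2.

Lemma D_analytic a1 h1 a2 h2 d : regular (a1 - d) h1 -> regular (a2 - d) h2 ->
  analytic_at (D a1 h1 a2 h2) d.
Proof.
have A a h : regular (a - d) h -> analytic_at (fun u => G (a - u) h) d.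
  move=> reg; have := @rate_int_analytic (-1) a d h (normrN1 _); rewrite mulN1r => /(_ reg).
  by rewrite (_ : (fun u => _) = (fun u => G (a - u) h))//; apply/funext => u; rewrite mulN1r.
by move=> /A r1 /A r2; exact: analytic_at_sub.
Qed.

(** As [d] tends to [a1], the first integral blows up, since [h1 <= 2^-1], while the second stays
    bounded, since [a2 != a1]. *)
Lemma D_neq0_near a1 h1 a2 h2 : a1 != a2 -> 0 <= h1 <= 2^-1 ->
  exists2 rho, 0 < rho & forall d, 0 < `|d - a1| < rho -> D a1 h1 a2 h2 d != 0.
Proof.
move=> a12 /andP[h10 h12].
have a120 : 0 < `|a1 - a2| by rewrite normr_gt0 subr_eq0.
pose e := `|a1 - a2| / 2; have e0 : 0 < e by rewrite divr_gt0.
have [q /andP[q0 _] H] := rate_int_blowup al0 s0 ((e ^+ 2)^-1).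
exists (Num.min q e); first by rewrite lt_min q0 e0.
move=> d /andP[d0]; rewrite lt_min => /andP[dq de].
have ed : e < `|a2 - d|.
  have : `|a1 - a2| <= `|d - a1| + `|a2 - d|.
    by rewrite (_ : a1 - a2 = - ((d - a1) + (a2 - d))) ?normrN ?ler_normD//; ring.
  by rewrite /e in de *; lra.
have a2d : a2 - d != 0 by rewrite -normr_gt0 (lt_trans e0).
have a1d : a1 - d != 0 by rewrite -normr_gt0 distrC.
rewrite gt_eqF// subr_gt0; apply: (@le_lt_trans _ _ (e ^+ 2)^-1).
  apply: (le_trans (rate_int_decayl al0 s0 _ a2d)).
  have ad2 : 0 < (a2 - d) ^+ 2 by rewrite exprn_even_gt0.
  rewrite lef_pV2 ?posrE ?(exprn_gt0 2 e0)//.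
  by rewrite -(real_normK (num_real (a2 - d))) lerXn2r// ?nnegrE// ltW.
by apply: H => //; [left|lra|rewrite distrC ltW].
Qed.

(** [D] is analytic except at [d = a1] if [h1 <= 2^-1] and at [d = a2] if [h2 <= 2^-1]. These
    singular points cut the line into intervals, and [D_neq0_near] at a singular end shows that [D]
    is not identically zero on each of them. *)
Lemma countable_transversal a1 h1 a2 h2 : a1 != a2 -> 0 <= h1 -> 0 <= h2 ->
  countable [set d | [/\ regular (a1 - d) h1, regular (a2 - d) h2 &
                        G (a1 - d) h1 = G (a2 - d) h2]].
Proof.
move=> a12 h10 h20.
pose Z a1 h1 a2 h2 := [set d | [/\ regular (a1 - d) h1, regular (a2 - d) h2 &
  G (a1 - d) h1 = G (a2 - d) h2]].
suff H (i : interval R) b1 k1 b2 k2 : (exists2 x, x \in i & D b1 k1 b2 k2 x != 0) ->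
    open [set` i] ->
    (forall x, x \in i -> regular (b1 - x) k1 /\ regular (b2 - x) k2) ->
    countable ([set` i] `&` Z b1 k1 b2 k2).
  have nreg b k x : x != b -> regular (b - x) k by move=> xb; left; rewrite subr_eq0 eq_sym.
  have regh b k x : 2^-1 < k -> regular (b - x) k by right.
  have sym b1 k1 b2 k2 : countable (Z b1 k1 b2 k2) -> countable (Z b2 k2 b1 k1).
    by apply: sub_countable; apply: subset_card_le => x [? ? ?]; split.
  have nearD b1 k1 b2 k2 (i : interval R) : b1 != b2 -> 0 <= k1 <= 2^-1 ->
      (forall e, 0 < e -> exists2 x, x \in i & 0 < `|x - b1| < e) ->
      exists2 x, x \in i & D b1 k1 b2 k2 x != 0.
    move=> b12 k12 Hi; have [rho rho0 Hr] := D_neq0_near k2 b12 k12.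
    by have [x xi xr] := Hi _ rho0; exists x => //; exact: Hr.
  have DC b1 k1 b2 k2 x : (D b1 k1 b2 k2 x != 0) = (D b2 k2 b1 k1 x != 0).
    by rewrite -oppr_eq0 opprB.
  have left_pt b e : 0 < e -> 0 < `|b - e / 2 - b| < e.
    by move=> e0; rewrite addrC addrA addNr add0r normrN gtr0_norm ?divr_gt0//; lra.
  have right_pt b e : 0 < e -> 0 < `|b + e / 2 - b| < e.
    by move=> e0; rewrite addrC addrA addNr add0r gtr0_norm ?divr_gt0//; lra.
  have one b1 k1 b2 k2 : b1 != b2 -> 0 <= k1 <= 2^-1 -> 2^-1 < k2 -> countable (Z b1 k1 b2 k2).
    move=> b12 k12 k22.
    apply: (@sub_countable _ _ _ ([set b1] `|` (`]-oo, b1[ `&` Z b1 k1 b2 k2) `|`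
                                   (`]b1, +oo[ `&` Z b1 k1 b2 k2))).
      apply: subset_card_le => x Zx; rewrite /setU/= !in_itv/= andbT.
      by have [?|?|->] := ltgtP x b1; [left; right|right|left; left].
    apply: countable_setU; first apply: countable_setU; first exact: countable1.
      apply: H; [|exact: interval_open|].
        apply: nearD => // e e0; exists (b1 - e / 2); last exact: left_pt.
        by rewrite in_itv/=; lra.
      by move=> x; rewrite in_itv/= => xb; split; [apply: nreg; rewrite lt_eqF|exact: regh].
    apply: H; [|exact: interval_open|].
      apply: nearD => // e e0; exists (b1 + e / 2); last exact: right_pt.
      by rewrite in_itv/=; lra.
    by move=> x; rewrite in_itv/= andbT => xb; split; [apply: nreg; rewrite gt_eqF|exact: regh].
  have two b1 k1 b2 k2 : b1 < b2 -> 0 <= k1 <= 2^-1 -> 0 <= k2 <= 2^-1 -> countable (Z b1 k1 b2 k2).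
    move=> b12 k12 k22; have b12' : b1 != b2 by rewrite lt_eqF.
    apply: (@sub_countable _ _ _ ([set b1; b2] `|` (`]-oo, b1[ `&` Z b1 k1 b2 k2) `|`
      (`]b1, b2[ `&` Z b1 k1 b2 k2) `|` (`]b2, +oo[ `&` Z b1 k1 b2 k2))).
      apply: subset_card_le => x Zx; rewrite /setU/= !in_itv/= andbT.
      have [xb|xb|->] := ltgtP x b1; [by left; left; right| |by do 3 left; left].
      by have [?|?|->] := ltgtP x b2; [left; right|right|do 3 left; right].
    apply: countable_setU; first apply: countable_setU; first apply: countable_setU.
    - by apply: countable_setU; exact: countable1.
    - apply: H; [|exact: interval_open|].
        apply: nearD => // e e0; exists (b1 - e / 2); last exact: left_pt.
        by rewrite in_itv/=; lra.
      by move=> x; rewrite in_itv/= => xb; split; apply: nreg; rewrite lt_eqF// (lt_trans xb).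
    - apply: H; [|exact: interval_open|].
        apply: nearD => // e e0; exists (b1 + (Num.min e (b2 - b1)) / 2).
          have : Num.min e (b2 - b1) <= b2 - b1 by rewrite ge_min lexx orbT.
          have : 0 < Num.min e (b2 - b1) by rewrite lt_min e0 subr_gt0.
          by rewrite in_itv/= => ? ?; apply/andP; split; lra.
        have m0 : 0 < Num.min e (b2 - b1) by rewrite lt_min e0 subr_gt0.
        have /andP[-> h] := right_pt b1 _ m0.
        by rewrite (lt_le_trans h)// ge_min lexx.
      move=> x; rewrite in_itv/= => /andP[xb1 xb2].
      by split; apply: nreg; [rewrite gt_eqF|rewrite lt_eqF].
    - apply: H; [|exact: interval_open|].
        have [||x xi xD] := @nearD b2 k2 b1 k1 `]b2, +oo[ _ k22 _.
        + by rewrite eq_sym.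
        + move=> e e0; exists (b2 + e / 2); last exact: right_pt.
          by rewrite in_itv/=; lra.
        + by exists x => //; rewrite DC.
      move=> x; rewrite in_itv/= andbT => xb.
      by split; apply: nreg; rewrite gt_eqF// (lt_trans b12).
  have [h12|h12] := leP h1 2^-1; have [h22|h22] := leP h2 2^-1.
  - have [lt|lt|E] := ltgtP a1 a2; last by rewrite E eqxx in a12.
      by apply: two => //; rewrite ?h10 ?h20.
    by apply: sym; apply: two => //; rewrite ?h10 ?h20.
  - by apply: one => //; rewrite h10.
  - by apply: sym; apply: one => //; [rewrite eq_sym|rewrite h20].
  - have := @H `]-oo, +oo[ a1 h1 a2 h2; rewrite set_itvNyy setTI; apply.
    (* Without singular points, zeros at both [a1] and [a2] would give, with [e = a1 - a2], [G 0 h1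
       = G e h2 < G 0 h2 = G e h1 < G 0 h1]. *)
    + have r0 e h : 2^-1 < h -> regular e h by right.
      have n12 : `|0 : R| < `|a1 - a2| by rewrite normr0 normr_gt0 subr_eq0.
      have [E|] := eqVneq (D a1 h1 a2 h2 a1) 0; last by exists a1.
      exists a2 => //; apply/eqP; rewrite /D !subrr => E2.
      move: E; rewrite /D subrr -[G (a2 - a1) h2]rate_int_normr distrC => E.
      have := rate_int_decrl al0 s0 (r0 0 h1 h12) n12.
      have := rate_int_decrl al0 s0 (r0 0 h2 h22) n12.
      by move: E; rewrite -[G (a1 - a2) h2]rate_int_normr; lra.
    + exact: openT.
    + by move=> x _; split; right.
move=> [x xi xD] oi reg.
apply: (@sub_countable _ _ _ ([set` i] `&` [set d | D b1 k1 b2 k2 d = 0])).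
  by apply: subset_card_le => d [di [_ _ E]]; split=> //=; rewrite /D E subrr.
apply: analytic_zeros_countable => //; first exact: interval_is_interval.
  by move=> d /reg[r1 r2]; exact: D_analytic.
by exists x.
Qed.

End ZeroSets.

(** * Level curves as graphs, and their intersections *)

Section LevelSets.
Variables (R : realType) (al s : R).
Hypotheses (al0 : 0 <= al) (s0 : 0 < s).
Implicit Types (a e h t x y r c d A : R).
Local Notation G := (rate_int al s).

(** [A] is the half-width of the level curve of [c]: the curve has height [0] at [|a| = A] and
    positive height over [|a| < A]. *)
Lemma level_radius c : 0 < c -> exists2 A, 0 < A & G A 0 = c.
Proof.
move=> c0; have [q /andP[q0 _] H] := rate_int_blowup al0 s0 c.
have rq : regular q 0 by left; rewrite gt_eqF.
have Gq : c < G q 0 by apply: H => //; rewrite ?gtr0_norm//; lra.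
pose B := Num.max q (c^-1 + 1).
have qB : q <= B by rewrite le_max lexx.
have B0 : 0 < B by exact: lt_le_trans qB.
have GB : G B 0 <= c.
  apply: (le_trans (rate_int_decayl al0 s0 0 _)); first by rewrite gt_eqF.
  have cB : c^-1 + 1 <= B by rewrite le_max lexx orbT.
  have c'0 : 0 < c^-1 by rewrite invr_gt0.
  rewrite -[leRHS]invrK lef_pV2 ?posrE ?exprn_gt0//; nra.
have [||x xi Gx] := @IVT _ (G^~ 0) _ _ c qB.
- apply: continuous_in_subspaceT => u /[!inE]/=; rewrite in_itv/= => /andP[qu _].
  by apply: rate_int_continuousl => //; left; rewrite gt_eqF// (lt_le_trans q0).
- by rewrite ge_min le_max GB (ltW Gq) orbT.
- by exists x => //; move: xi; rewrite in_itv/= => /andP[qx _]; exact: lt_le_trans qx.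
Qed.

Lemma level_exists c A a : 0 < A -> G A 0 = c -> `|a| < A ->
  exists h, [/\ 0 < h, regular a h & G a h = c].
Proof.
move=> A0 GA aA.
have regA h : regular A h by left; rewrite gt_eqF.
have c0 : 0 < c by rewrite -GA; exact: rate_int_gt0.
have [k [k0 rk Gk]] : exists k, [/\ 0 <= k, regular a k & c < G a k].
  have [->|a0] := eqVneq a 0.
    have [q /andP[q0 _] H] := rate_int_blowup al0 s0 c.
    exists (2^-1 + q); split; [lra|right; lra|].
    by apply: H; rewrite ?normr0 ?lexx//; [right; lra|lra|exact: ltW].
  exists 0; split=> //; first by left.
  by rewrite -GA; apply: rate_int_decrl => //; [left|rewrite [ltRHS]gtr0_norm].
(* From this height on, [rate_int_decayr] bounds [G a] by the inverse square of [1 + c^-1], which is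
   at most [c]. *)
pose m := Num.max k (2^-1 + (1 + c^-1) / s).
have km : k <= m by rewrite le_max lexx.
have c'0 : 0 < c^-1 by rewrite invr_gt0.
have sc : 0 < (1 + c^-1) / s by rewrite divr_gt0//; lra.
have mm : 2^-1 + (1 + c^-1) / s <= m by rewrite le_max lexx orbT.
have Gm : G a m <= c.
  apply: (le_trans (rate_int_decayr al0 s0 _ _)); first by lra.
  have : 1 + c^-1 <= s * (m - 2^-1) by rewrite mulrC -ler_pdivrMr//; lra.
  move=> h; rewrite -[leRHS]invrK lef_pV2 ?posrE ?exprn_gt0//; nra.
have [||x xi Gx] := @IVT _ (G a) _ _ c km.
- apply: continuous_in_subspaceT => u /[!inE]/=; rewrite in_itv/= => /andP[ku _].
  by apply: rate_int_continuousr => //; exact: regular_le rk.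
- by rewrite ge_min le_max Gm (ltW Gk) orbT.
- move: xi; rewrite in_itv/= => /andP[kx _].
  exists x; split=> //; last exact: regular_le rk.
  rewrite (le_lt_trans k0)// lt_neqAle kx andbT; apply: contraTneq Gk => ->.
  by rewrite Gx ltxx.
Qed.

Lemma level_inside c A a h : 0 < A -> G A 0 = c -> 0 < h -> regular a h -> G a h = c ->
  `|a| < A.
Proof.
move=> A0 GA h0 reg Gc; rewrite ltNge; apply/negP => Aa.
have ra : regular a 0 by left; rewrite -normr_gt0 (lt_le_trans A0).
have := rate_int_decrr al0 s0 ra (lexx _) h0; rewrite Gc -GA.
move: Aa; rewrite le_eqVlt => /orP[/eqP ->|Aa]; first by rewrite rate_int_normr ltxx.
have rA : regular A 0 by left; rewrite gt_eqF.
move=> lt; have := @rate_int_decrl _ al s al0 s0 A a 0 rA.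
by rewrite [`|A|]gtr0_norm// => /(_ Aa) /(lt_trans lt); rewrite ltxx.
Qed.

Lemma level_boundary c A a : 0 < A -> G A 0 = c -> regular a 0 -> G a 0 = c -> `|a| = A.
Proof.
move=> A0 GA ra Gc; have rA : regular A 0 by left; rewrite gt_eqF.
have nA : `|A| = A by rewrite gtr0_norm.
have [lt|lt|//] := ltgtP `|a| A.
  by have := @rate_int_decrl _ al s al0 s0 a A 0 ra; rewrite nA Gc GA ltxx => /(_ lt).
by have := @rate_int_decrl _ al s al0 s0 A a 0 rA; rewrite nA Gc GA ltxx => /(_ lt).
Qed.

(** [H] may be chosen pointwise: strict monotonicity in [h] makes the height unique, so near each
    point [H] coincides with the analytic branch of [level_analytic]. The last clause says that [H]
    tends to [0] at the ends. *)
Lemma level_graph c A : 0 < A -> G A 0 = c -> exists H : R -> R, [/\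
  forall a, `|a| < A -> [/\ 0 < H a, regular a (H a) & G a (H a) = c],
  forall a, `|a| < A -> analytic_at H a &
  forall e, 0 < e -> exists2 rho, 0 < rho & forall a, A - rho < `|a| < A -> H a < e].
Proof.
move=> A0 GA.
have ex a : exists h, `|a| < A -> [/\ 0 < h, regular a h & G a h = c].
  have [aA|?] := ltP `|a| A; last by exists 0.
  by have [h hP] := level_exists A0 GA aA; exists h.
have [H HP] := choice ex; exists H; split=> // [a aA|e e0].
  have [h0 reg Gc] := HP a aA.
  have [r [M [phi [aphi phiP]]]] := level_analytic al0 s0 reg h0 Gc.
  have r0 := ana_gt0 aphi.
  pose r' := Num.min r (A - `|a|).
  have r'0 : 0 < r' by rewrite lt_min r0 subr_gt0.
  exists r', (M + `|H a|).
  have ashr : ana r' M phi by apply: ana_shrink aphi; rewrite r'0 ge_min lexx.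
  apply: eq_ana (ana_add ashr (ana_cst (H a) r'0)) => x.
  rewrite lt_min => /andP[xr xA].
  have [h1 reg1 G1] := phiP x xr.
  have aX : `|a + x| < A by apply: (le_lt_trans (ler_normD _ _)); lra.
  have [h2 reg2 G2] := HP _ aX.
  rewrite addrC; apply: (rate_int_injr al0 s0 reg1 reg2); rewrite ?(ltW h1) ?(ltW h2)//.
  by rewrite G1 G2.
have rA h : regular A h by left; rewrite gt_eqF.
have lt : G A e < c by rewrite -GA; exact: rate_int_decrr.
have := @rate_int_continuousl _ al s al0 s0 A e (rA e).
move=> /cvgrPdist_lt /(_ (c - G A e)); rewrite subr_gt0 => /(_ lt) [rho /= rho0 Hrho].
exists (Num.min rho A) => [|a /andP[ra aA]]; first by rewrite lt_min rho0 A0.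
have rho1 : Num.min rho A <= rho by rewrite ge_min lexx.
have rho2 : Num.min rho A <= A by rewrite ge_min lexx orbT.
have [h0 reg Gc] := HP a aA.
have Gae : G `|a| e < c.
  have := Hrho `|a|; rewrite /ball_/= ger0_norm ?subr_ge0 ?(ltW aA)// => /(_ ltac:(lra)).
  by rewrite ltr_norml => /andP[? ?]; lra.
have rega : regular a e by left; rewrite -normr_gt0; lra.
rewrite ltNge; apply/negP => eH.
move: Gae; rewrite rate_int_normr -Gc ltNge => /negP; apply.
move: eH; rewrite le_eqVlt => /orP[/eqP ->//|eH].
by apply: ltW; apply: rate_int_decrr => //; exact: ltW.
Qed.

(** The second graph ends at [p], so [H2] is small nearby, whereas [H1] stays close to
    [H1 p > 0]. *)
Lemma end_mismatch (W : set R) (H1 H2 : R -> R) A2 o2 p :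
  {for p, continuous H1} -> 0 < H1 p -> `|p - o2| = A2 ->
  (forall w, W w -> `|w - o2| < A2) ->
  (forall e, 0 < e -> exists2 rho, 0 < rho & forall w, A2 - rho < `|w - o2| < A2 -> H2 w < e) ->
  (forall e, 0 < e -> exists2 w, W w & `|w - p| < e) ->
  exists2 w, W w & H1 w != H2 w.
Proof.
move=> /cvgrPdist_lt cH H1p pA WA end2 Wp.
have e0 : 0 < H1 p / 2 by rewrite divr_gt0.
have [r1 /= r10 Hr1] := cH _ e0; have [r2 r20 Hr2] := end2 _ e0.
have [|w Ww wp] := Wp (Num.min r1 r2); first by rewrite lt_min r10.
move: wp; rewrite lt_min => /andP[wr1 wr2].
exists w => //; have /Hr1 : ball_ Num.norm p r1 w by rewrite /ball_/= distrC.
rewrite ltr_norml => /andP[_ h1].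
have /Hr2 h2 : A2 - r2 < `|w - o2| < A2.
  rewrite WA// andbT -pA.
  have : `|p - o2| <= `|w - p| + `|w - o2|.
    by rewrite (_ : p - o2 = - (w - p) + (w - o2)) ?(le_trans (ler_normD _ _)) ?normrN//; ring.
  by lra.
by rewrite gt_eqF//; lra.
Qed.

(** Apart from the ends, where [h = 0], [a] is a point where the level curve of [c] meets that of
    [c'] translated by [d]. Two analytic graphs that differ somewhere over their common interval [W]
    meet countably often. *)
Lemma countable_level c c' d : d != 0 -> 0 < c -> 0 < c' ->
  countable [set a | exists h, [/\ 0 <= h, regular a h, regular (a - d) h,
    G a h = c & G (a - d) h = c']].
Proof.
move=> d0 c0 c'0.
have [A A0 GA] := level_radius c0; have [A' A'0 GA'] := level_radius c'0.
have [H [HP Ha He]] := level_graph A0 GA; have [H' [H'P H'a H'e]] := level_graph A'0 GA'.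
pose l := Num.max (- A) (d - A'); pose r := Num.min A (d + A').
pose W := [set` `]l, r[].
have WE w : W w <-> `|w| < A /\ `|w - d| < A'.
  rewrite /W/= in_itv/= /l /r gt_max lt_min !ltr_norml; split.
    by move=> /andP[/andP[? ?] /andP[? ?]]; split; apply/andP; split; lra.
  by move=> [/andP[? ?] /andP[? ?]]; apply/andP; split; apply/andP; split; lra.
apply: (@sub_countable _ _ _ ([set A; - A] `|` (W `&` [set a | H a - H' (a - d) = 0]))).
  apply: subset_card_le => a [h [h0 reg reg' Gc Gc']].
  have [h00|hn0] := eqVneq h 0.
    left; move: reg Gc; rewrite h00 => reg /(level_boundary A0 GA reg) <-.
    by have [a0|a0] := leP 0 a; [left; rewrite /= ger0_norm|right; rewrite /= ltr0_norm// opprK].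
  have hp : 0 < h by rewrite lt_neqAle eq_sym hn0.
  have aA := level_inside A0 GA hp reg Gc.
  have aA' := level_inside A'0 GA' hp reg' Gc'.
  right; split; first exact/WE.
  have [k0 rk Gk] := HP a aA; have [k0' rk' Gk'] := H'P _ aA'.
  rewrite /= (rate_int_injr al0 s0 rk reg (ltW k0) h0) ?Gk//.
  by rewrite (rate_int_injr al0 s0 rk' reg' (ltW k0') h0) ?Gk'// subrr.
apply: countable_setU; first by apply: countable_setU; exact: countable1.
have [lr|rl] := ltP l r; last first.
  rewrite (_ : _ `&` _ = set0) ?countable0// predeqE => w; split=> //= -[+ _].
  by rewrite /W/= in_itv/= => /andP[? ?]; lra.
have shift_an a : `|a - d| < A' -> analytic_at (fun a => H' (a - d)) a.
  move=> aA'; have [q [M aq]] := H'a _ aA'; exists q, M.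
  by apply: eq_ana aq => x _; rewrite addrAC.
apply: analytic_zeros_countable.
- exact: interval_open.
- exact: interval_is_interval.
- by move=> x /WE[xA xA']; apply: analytic_at_sub; [exact: Ha|exact: shift_an].
suff [w Ww Hw] : exists2 w, W w & H w != H' (w - d) by exists w => //; rewrite subr_eq0.
have lr_l e : 0 < e -> exists2 w, W w & `|w - l| < e.
  move=> e0; have : 0 < Num.min e (r - l) by rewrite lt_min e0 subr_gt0.
  have : Num.min e (r - l) <= e by rewrite ge_min lexx.
  have : Num.min e (r - l) <= r - l by rewrite ge_min lexx orbT.
  move: (Num.min e (r - l)) => m mr me m0; exists (l + m / 2).
    by rewrite /W/= in_itv/=; apply/andP; split; lra.
  by rewrite (_ : _ - _ = m / 2) ?gtr0_norm ?divr_gt0//; [lra|ring].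
have lr_r e : 0 < e -> exists2 w, W w & `|w - r| < e.
  move=> e0; have : 0 < Num.min e (r - l) by rewrite lt_min e0 subr_gt0.
  have : Num.min e (r - l) <= e by rewrite ge_min lexx.
  have : Num.min e (r - l) <= r - l by rewrite ge_min lexx orbT.
  move: (Num.min e (r - l)) => m mr me m0; exists (r - m / 2).
    by rewrite /W/= in_itv/=; apply/andP; split; lra.
  by rewrite (_ : _ - _ = - (m / 2)) ?normrN ?gtr0_norm ?divr_gt0//; [lra|ring].
have mism p : `|p| < A -> `|p - d| = A' -> (forall e, 0 < e -> exists2 w, W w & `|w - p| < e) ->
    exists2 w, W w & H w != H' (w - d).
  move=> pA pA'; have [Hp _ _] := HP p pA.
  apply: (@end_mismatch W H (fun a => H' (a - d)) A' d p) => //.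
  - exact: analytic_at_continuous (Ha p pA).
  - by move=> w /WE[].
  - by move=> e /H'e[rho rho0 Hr]; exists rho => // w; exact: Hr.
have mism' p : `|p - d| < A' -> `|p| = A -> (forall e, 0 < e -> exists2 w, W w & `|w - p| < e) ->
    exists2 w, W w & H w != H' (w - d).
  move=> pA' pA Wp; have [Hp _ _] := H'P _ pA'.
  have [||||||w Ww] := @end_mismatch W (fun a => H' (a - d)) H A 0 p => //.
  - exact: analytic_at_continuous (shift_an p pA').
  - by rewrite subr0.
  - by move=> w /WE[]; rewrite subr0.
  - by move=> e /He[rho rho0 Hr]; exists rho => // w; rewrite subr0; exact: Hr.
  - by exists w => //; rewrite eq_sym.
have rA : r <= A by rewrite ge_min lexx.
have rA' : r <= d + A' by rewrite ge_min lexx orbT.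
have lA : - A <= l by rewrite le_max lexx.
have lA' : d - A' <= l by rewrite le_max lexx orbT.
(* If the curves ended together on both sides, [- A = d - A'] and [A = d + A'] would give [d = 0].
   On a side where they do not, one graph ends strictly inside the interval of the other, and
   [end_mismatch] applies. *)
have [lt|lt|E] := ltgtP (- A) (d - A').
- have lE : l = d - A' by rewrite /l max_r ?ltW.
  apply: (mism l) => //; first by rewrite ltr_norml; apply/andP; split; lra.
  by rewrite lE addrAC subrr add0r normrN gtr0_norm.
- have lE : l = - A by rewrite /l max_l ?ltW.
  apply: (mism' l) => //; last by rewrite lE normrN gtr0_norm.
  by rewrite ltr_norml; apply/andP; split; lra.
have [lt|lt|E'] := ltgtP A (d + A').
- have rE : r = A by rewrite /r min_l ?ltW.
  apply: (mism' r) => //; last by rewrite rE gtr0_norm.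
  by rewrite ltr_norml; apply/andP; split; lra.
- have rE : r = d + A' by rewrite /r min_r ?ltW.
  apply: (mism r) => //; first by rewrite ltr_norml; apply/andP; split; lra.
  by rewrite rE addrAC subrr add0r gtr0_norm.
- by case/eqP: d0; lra.
Qed.

End LevelSets.

(** * Time stamps and identification of the direction *)

Section TimeStamps.
Variables (R : realType) (al s : R).
Hypotheses (al0 : 0 <= al) (s0 : 0 < s).
Implicit Types (a e h t x y r c d p m : R).
Local Notation mu := (@lebesgue_measure R).
Local Notation K := (rate al s).
Local Notation Gam := (erate_int al s).

Lemma measurable_rateE p (D : set R) : measurable_fun D (fun t => (K p t)%:E).
Proof. by apply/measurable_EFinP; apply: measurable_funTS; exact: measurable_rate. Qed.

Lemma rateN p t : K p (- t) = K p t.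
Proof. by rewrite /rate mulrN sqrrN. Qed.

Lemma measurable_shift m :
  measurable_fun [set: measurableTypeR R] (fun t : measurableTypeR R => (t : R) - m : measurableTypeR R).
Proof. by apply: measurable_funB => //; exact: measurable_cst. Qed.

Let shift_mixin m := isMeasurableFun.Build _ _ _ _ _ (measurable_shift m).
Let shift_mfun m : {mfun measurableTypeR R >-> measurableTypeR R} :=
  HB.pack (fun t : measurableTypeR R => (t : R) - m : measurableTypeR R) (shift_mixin m).

Lemma erate_int_shift p m t :
  (\int[mu]_(x in `[(t - 2^-1)%R, (t + 2^-1)%R]) (K p (x - m))%:E)%E = Gam p (t - m).
Proof.
have mf := @measurable_shift m.
rewrite (_ : [set` `[t - 2^-1, t + 2^-1]] =
    (fun t : measurableTypeR R => (t : R) - m : measurableTypeR R) @^-1` `[(t - m - 2^-1), (t - m + 2^-1)]); last first.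
  by apply/seteqP; split=> x; rewrite /= !in_itv/= => /andP[? ?]; apply/andP; split; lra.
rewrite -(@ge0_integral_pushforward _ _ _ _ _ _ mf mu _ (fun x => (K p x)%:E))//=.
- apply: (@eq_measure_integral _ _ _ _ mu (pushforward mu (shift_mfun m))) => A mA _.
  apply/esym/lebesgue_measure_unique => //= _ [[a b]] _ <-; rewrite /pushforward.
  rewrite (_ : _ @^-1` _ = `](a + m), (b + m)]%classic); last first.
    by apply/seteqP; split=> x; rewrite /= !in_itv/= => /andP[? ?]; apply/andP; split; lra.
  by rewrite !lebesgue_measure_itv/= !lte_fin ltrD2r -!EFinD (_ : b + m - (a + m) = b - a)//; ring.
- exact: measurable_rateE.
- by move=> x _; rewrite lee_fin rate_ge0.
Qed.

Lemma measurable_oppT :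
  measurable_fun [set: measurableTypeR R] (-%R : measurableTypeR R -> measurableTypeR R).
Proof. exact: oppr_measurable. Qed.

Let opp_mixin := isMeasurableFun.Build _ _ _ _ _ measurable_oppT.
Let opp_mfun : {mfun measurableTypeR R >-> measurableTypeR R} :=
  HB.pack (-%R : measurableTypeR R -> measurableTypeR R) opp_mixin.

Lemma erate_intN p h : Gam p (- h) = Gam p h.
Proof.
rewrite /erate_int.
rewrite (_ : [set` `[- h - 2^-1, - h + 2^-1]] =
    (-%R : measurableTypeR R -> measurableTypeR R) @^-1` `[(h - 2^-1), (h + 2^-1)]); last first.
  by apply/seteqP; split=> x; rewrite /= !in_itv/= => /andP[? ?]; apply/andP; split; lra.
under eq_integral do rewrite -rateN.
rewrite -(@ge0_integral_pushforward _ _ _ _ _ _ measurable_oppT mu _ (fun x => (K p x)%:E))//=.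
- apply: (@eq_measure_integral _ _ _ _ mu (pushforward mu opp_mfun)) => A mA _.
  exact: lebesgue_measureN.
- exact: measurable_rateE.
- by move=> x _; rewrite lee_fin rate_ge0.
Qed.

(** This turns the threshold inequality at the last time stamp into an equality. As [Gam p] may be
    [+oo], monotone convergence replaces continuity: the window at [h], less a short initial piece,
    lies in the window at a slightly later time. *)
Lemma erate_int_right_lsc p h c : (forall t, h < t -> (Gam p t <= c%:E)%E) -> (Gam p h <= c%:E)%E.
Proof.
move=> H; pose F n : set R := [set` `[(h - 2^-1 + n.+1%:R^-1), (h + 2^-1)]].
have UF : \bigcup_n F n = [set` `](h - 2^-1), (h + 2^-1)]].
  apply/seteqP; split=> [x [n _]|x]; rewrite /= !in_itv/= => /andP[]; rewrite ?bnd_simp => hx xh.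
    have n0 : 0 < n.+1%:R^-1 :> R by rewrite invr_gt0 ltr0n.
    move: (n.+1%:R^-1) n0 hx => v v0 hx. apply/andP; split; lra.
  have xh0 : 0 < x - (h - 2^-1) by lra.
  have [n _ Hn] := near_infty_natSinv_lt (PosNum xh0).
  exists n => //; rewrite /F/= in_itv/= xh andbT -lerBrDl.
  exact/ltW/(Hn n (leqnn _)).
have ndF : nondecreasing_seq F.
  move=> n k nk; apply/subsetPset => x; rewrite /F/= !in_itv/= => /andP[]; rewrite ?bnd_simp => hx ->; rewrite andbT.
  rewrite (le_trans _ hx)// lerD2l lef_pV2 ?posrE ?ltr0n// ler_nat ltnS//.
have := @ge0_nondecreasing_set_cvg_integral _ (measurableTypeR R) _ F (fun x => (K p x)%:E) mu ndF.
move=> /(_ (fun _ => measurable_itv _) (fun _ => @measurable_rateE p _)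
  (fun _ x _ => rate_ge0 _ _ _ _)).
rewrite UF integral_itv_obnd_cbnd; last exact: measurable_rateE.
move=> cF; rewrite /erate_int -(cvg_lim (@ereal_hausdorff R) cF); apply: lime_le.
  by apply/cvg_ex; eexists; exact: cF.
near=> n; have n0 : 0 < n.+1%:R^-1 :> R by rewrite invr_gt0 ltr0n.
apply: le_trans (H (h + n.+1%:R^-1) _); last by rewrite ltrDl.
apply: ge0_subset_integral => //=.
- exact: measurable_itv.
- exact: measurable_rateE.
- by move=> x _; rewrite lee_fin rate_ge0.
- move=> x; rewrite /F /= !in_itv/=; move: (n.+1%:R^-1 : R) n0 => v v0 /andP[? ?].
  by apply/andP; split; lra.
Unshelve. all: by end_near. Qed.

(** The superlevel set is symmetric about [m], so its least and greatest elements are mirror images.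
    The final equality also excludes an infinite integral at the time stamps. *)
Lemma time_stamps_level p m c t1 t2 :
  is_min_of [set t | (c%:E <= Gam p (t - m))%E] t1 ->
  is_max_of [set t | (c%:E <= Gam p (t - m))%E] t2 ->
  [/\ t1 + t2 = 2 * m, 0 <= (t2 - t1) / 2 & Gam p ((t2 - t1) / 2) = c%:E].
Proof.
move=> [/= S1 min1] [/= S2 max2].
have refl t : (c%:E <= Gam p (t - m))%E -> (c%:E <= Gam p (2 * m - t - m))%E.
  by rewrite -erate_intN (_ : - (t - m) = 2 * m - t - m)//; ring.
have E : t1 + t2 = 2 * m.
  by have := min1 _ (refl _ S2); have := max2 _ (refl _ S1) => /= ? ?; lra.
have h0 : 0 <= (t2 - t1) / 2 by have := min1 _ S2 => /= ?; lra.
have hE : (t2 - t1) / 2 = t2 - m by lra.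
split=> //; rewrite hE; apply/eqP; rewrite eq_le S2 andbT.
apply: erate_int_right_lsc => t tm; rewrite leNgt; apply/negP => lt.
have := max2 (t + m) => /=; rewrite addrK => /(_ (ltW lt)); lra.
Qed.

(** The source moves along [(sin th, cos th)]. The component of the sensor position along the normal
    [(cos th, - sin th)] is the signed distance; the one along the motion gives the time of closest
    approach. *)
Lemma window_intE xo yo th t0 (q : R * R) t :
  window_int al xo yo th s t0 q t =
  Gam ((q.1 - xo) * cos th - (q.2 - yo) * sin th)
    (t - (t0 + ((q.1 - xo) * sin th + (q.2 - yo) * cos th) / s)).
Proof.
rewrite -erate_int_shift /window_int; apply: eq_integral => u _; congr EFin.
have E : ((traj xo yo th s t0 u).1 - q.1) ^+ 2 + ((traj xo yo th s t0 u).2 - q.2) ^+ 2 =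
  ((q.1 - xo) * cos th - (q.2 - yo) * sin th) ^+ 2 +
  (s * (u - (t0 + ((q.1 - xo) * sin th + (q.2 - yo) * cos th) / s))) ^+ 2.
  have sE : s * (u - (t0 + ((q.1 - xo) * sin th + (q.2 - yo) * cos th) / s)) =
     s * (u - t0) - ((q.1 - xo) * sin th + (q.2 - yo) * cos th) by field; rewrite gt_eqF.
  rewrite sE /traj/=; set X := q.1 - xo; set Y := q.2 - yo; set w := s * (u - t0).
  rewrite (_ : xo + w * sin th - q.1 = w * sin th - X); last by rewrite /X; ring.
  rewrite (_ : yo + w * cos th - q.2 = w * cos th - Y); last by rewrite /Y; ring.
  apply/eqP; rewrite -subr_eq0.
  rewrite (_ : _ - _ = (cos th ^+ 2 + sin th ^+ 2 - 1) * (w ^+ 2 - X ^+ 2 - Y ^+ 2)); last by ring.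
  by rewrite cos2Dsin2 subrr mul0r.
by rewrite /dist2 /rate E sqr_sqrtr// addr_ge0 ?sqr_ge0.
Qed.

End TimeStamps.

Section Identification.
Variable R : realType.
Implicit Types (x y th s : R).

Lemma angle_unique (th th' : R) : 0 <= th < 2 * pi -> 0 <= th' < 2 * pi ->
  sin th = sin th' -> cos th = cos th' -> th = th'.
Proof.
wlog le : th th' / th <= th'.
  move=> H h h' Es Ec; have [le|le] := leP th th'; first exact: H.
  by apply/esym; apply: H => //; exact: ltW.
move=> /andP[th0 _] /andP[_ th'2] Es Ec; apply/eqP; rewrite eq_le le leNgt; apply/negP => lt.
pose d := (th' - th) / 2.
have d0 : 0 < d < pi by rewrite /d; apply/andP; split; lra.
have c1 : cos (d + d) = 1.
  by rewrite (_ : d + d = th' - th) ?cosB ?Es ?Ec -?expr2 ?cos2Dsin2// /d; field.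
have := sin_gt0_pi d0; have := cos2Dsin2 d; rewrite cosD in c1 => c2 sd; nra.
Qed.

Lemma trajectory_unique (Xs Ys : 'I_3 -> R) (t0 xo yo th s xo' yo' th' s' : R) (i j k : 'I_3) :
  (Xs j - Xs i) * (Ys k - Ys i) - (Xs k - Xs i) * (Ys j - Ys i) != 0 ->
  0 <= th < 2 * pi -> 0 <= th' < 2 * pi -> 0 < s -> 0 < s' ->
  (forall l, t0 + ((Xs l - xo) * sin th + (Ys l - yo) * cos th) / s =
             t0 + ((Xs l - xo') * sin th' + (Ys l - yo') * cos th') / s') ->
  [/\ th' = th, s' = s & (xo' - xo) * sin th + (yo' - yo) * cos th = 0].
Proof.
move=> ncol th2 th'2 s0 s'0 E.
(* [(u, v)] is the difference of the two slowness vectors, and it is orthogonal to two independent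
   sensor differences. As [(sin th, cos th)] has norm [1], equal slownesses give equal speeds, then
   equal angles. *)
pose u := sin th / s - sin th' / s'; pose v := cos th / s - cos th' / s'.
have H l l' : (Xs l - Xs l') * u + (Ys l - Ys l') * v = 0.
  have := E l; have := E l' => /addrI E1 /addrI E2.
  transitivity ((((Xs l - xo) * sin th + (Ys l - yo) * cos th) / s -
      ((Xs l - xo') * sin th' + (Ys l - yo') * cos th') / s') -
     (((Xs l' - xo) * sin th + (Ys l' - yo) * cos th) / s -
      ((Xs l' - xo') * sin th' + (Ys l' - yo') * cos th') / s')).
    by rewrite /u /v; ring.
  by rewrite E1 E2 !subrr.
have H1 := H j i; have H2 := H k i.
have u0 : u = 0.
  apply: (mulfI ncol); rewrite mulr0.
  transitivity ((Ys k - Ys i) * ((Xs j - Xs i) * u + (Ys j - Ys i) * v) -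
    (Ys j - Ys i) * ((Xs k - Xs i) * u + (Ys k - Ys i) * v)); first by ring.
  by rewrite H1 H2 !mulr0 subrr.
have v0 : v = 0.
  apply: (mulfI ncol); rewrite mulr0.
  transitivity ((Xs j - Xs i) * ((Xs k - Xs i) * u + (Ys k - Ys i) * v) -
    (Xs k - Xs i) * ((Xs j - Xs i) * u + (Ys j - Ys i) * v)); first by ring.
  by rewrite H1 H2 !mulr0 subrr.
have us : sin th / s = sin th' / s' by apply/eqP; rewrite -subr_eq0; apply/eqP.
have vs : cos th / s = cos th' / s' by apply/eqP; rewrite -subr_eq0; apply/eqP.
have s2 : (s^-1) ^+ 2 = (s'^-1) ^+ 2.
  rewrite -[LHS]mul1r -[RHS]mul1r -{1}(cos2Dsin2 th) -(cos2Dsin2 th').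
  by rewrite !mulrDl -!exprMn us vs.
have ss : s = s'.
  by apply: invr_inj; apply/eqP; rewrite -(@eqrXn2 _ 2)// ?invr_ge0 ?ltW//; apply/eqP.
have sn : s^-1 != 0 by rewrite invr_eq0 gt_eqF.
have Es : sin th = sin th' by apply: (mulIf sn); rewrite us ss.
have Ec : cos th = cos th' by apply: (mulIf sn); rewrite vs ss.
have tt := angle_unique th2 th'2 Es Ec.
split=> //; have := E i => /addrI; rewrite -ss -Es -Ec => /(mulIf sn) E1.
apply/eqP; rewrite -(subrr ((Xs i - xo) * sin th + (Ys i - yo) * cos th)) {2}E1; apply/eqP; ring.
Qed.

Lemma rotation_kernel (th dx dy : R) :
  dx * cos th - dy * sin th = 0 -> dx * sin th + dy * cos th = 0 -> dx = 0 /\ dy = 0.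
Proof.
move=> h1 h2; split.
  rewrite -[dx]mulr1 -(cos2Dsin2 th).
  transitivity ((dx * cos th - dy * sin th) * cos th + (dx * sin th + dy * cos th) * sin th).
    by ring.
  by rewrite h1 h2 !mul0r addr0.
rewrite -[dy]mulr1 -(cos2Dsin2 th).
transitivity ((dx * sin th + dy * cos th) * cos th - (dx * cos th - dy * sin th) * sin th).
  by ring.
by rewrite h1 h2 !mul0r subr0.
Qed.

End Identification.

(** * A measurable set of exceptional triples of signed distances *)

Section ExceptionalTriples.
Variables (R : realType) (al s : R).
Hypotheses (al0 : 0 <= al) (s0 : 0 < s).
Implicit Types (a e h t x y r c d A : R).
Local Notation mu := (@lebesgue_measure R).
Local Notation K := (rate al s).
Local Notation Gam := (erate_int al s).
Local Notation G := (rate_int al s).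

(** A translation of the variable makes the window independent of [h], which moves into the
    integrand; Tonelli's theorem then applies. *)
Lemma measurable_erate_int2 : measurable_fun [set: R * R] (fun p => Gam p.1 p.2).
Proof.
pose f (z : (R * R) * measurableTypeR R) : \bar R :=
  (K z.1.1 (z.2 + z.1.2) * \1_(`[(0 - 2^-1 : R), 0 + 2^-1]%classic : set R) z.2)%:E.
have mf : measurable_fun [set: (R * R) * measurableTypeR R] f.
  have m11 : measurable_fun [set: (R * R) * measurableTypeR R] (fun z => z.1.1 : R).
    exact: (measurableT_comp measurable_fst measurable_fst).
  have m12 : measurable_fun [set: (R * R) * measurableTypeR R] (fun z => z.1.2 : R).
    exact: (measurableT_comp measurable_snd measurable_fst).
  have m2 : measurable_fun [set: (R * R) * measurableTypeR R] (fun z => z.2 : R).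
    exact: measurable_snd.
  apply/measurable_EFinP; apply: measurable_funM.
    exact: (measurableT_comp (measurable_rate2 al s)
      (measurable_fun_pair m11 (measurable_funD m2 m12))).
  apply: (measurableT_comp _ m2); apply: measurable_indic; exact: measurable_itv.
have f0 z : (0 <= f z)%E by rewrite lee_fin mulr_ge0 ?rate_ge0// indicE.
have := @measurable_fun_fubini_tonelli_F _ _ _ _ _ mu f mf f0.
rewrite (_ : fubini_F _ _ = fun p => Gam p.1 p.2)//.
apply/funext => -[e h]; rewrite /fubini_F/=.
have -> : Gam e h = Gam e (0 - - h) by rewrite sub0r opprK.
rewrite -erate_int_shift// [RHS]integral_mkcond; apply: eq_integral => x _; rewrite epatch_indic/= opprK.
by rewrite /f/= EFinM.
Qed.

Lemma rate_int_ge0 e h : 0 <= G e h.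
Proof. by apply: fine_ge0; apply: integral_ge0 => x _; rewrite lee_fin rate_ge0. Qed.

(* Where the window integral is +oo, G is 0 by convention of [fine] and so is its inverse: this makes
   psi continuous across these points. *)
Definition psi e h : R := (G e h)^-1.

Lemma measurable_psi : measurable_fun [set: R * R] (fun p => psi p.1 p.2).
Proof.
rewrite (_ : (fun p => _) = (fun u => powR u (-1)) \o fine \o (fun p : R * R => Gam p.1 p.2)).
  apply: measurableT_comp; last exact: measurable_erate_int2.
  by apply: measurableT_comp; [exact: measurable_powR|exact: fine_measurable].
by apply/funext => p; rewrite /= powR_inv1// rate_int_ge0.
Qed.

Lemma psi_eq0 e h : 0 <= h -> psi e h = 0 -> ~ regular e h.
Proof.
by move=> h0 /eqP; rewrite invr_eq0 => /eqP E /(rate_int_gt0 al s0); rewrite E ltxx.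
Qed.

Lemma psi_irregular e h : 0 <= h -> ~ regular e h -> psi e h = 0.
Proof.
move=> h0 nreg; have [e0|e0] := eqVneq e 0; last by case: nreg; left.
rewrite /psi /rate_int e0 erate_int0_pinfty ?invr0// h0 leNgt/=; apply/negP => h2.
by apply: nreg; right.
Qed.

Lemma psi_continuous a h : 0 <= h -> continuous (fun d => psi (a - d) h).
Proof.
move=> h0 d; have [reg|nreg] := pselect (regular (a - d) h).
  apply: cvgV; first by rewrite gt_eqF// rate_int_gt0.
  apply: (@continuous_comp _ _ _ (fun d => a - d) (G^~ h)).
    by apply: cvgB; [exact: cvg_cst|exact: cvg_id].
  exact: rate_int_continuousl.
have ad : d = a.
  by apply/eqP; apply: contra_notT nreg => da; left; rewrite subr_eq0 eq_sym.
have h2 : h <= 2^-1 by rewrite leNgt; apply: contra_notN nreg => h2; right.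
move: nreg; rewrite ad => nreg; rewrite /continuous_at (psi_irregular h0 nreg); apply/cvgrPdist_lt => e e0.
have [q /andP[q0 _] H] := rate_int_blowup al0 s0 e^-1.
exists q => //= u; rewrite /ball_/= => uq.
rewrite sub0r normrN ger0_norm ?invr_ge0 ?rate_int_ge0//.
have [->|ua] := eqVneq u a; first by rewrite psi_irregular.
have reg : regular (a - u) h by left; rewrite subr_eq0 eq_sym.
by rewrite /psi -[ltRHS]invrK ltf_pV2 ?posrE ?invr_gt0 ?rate_int_gt0// H// ?ltW//; lra.
Qed.


(** [B] must not depend on the unknown [d] and [c']. Since [c] and a signed distance determine the
    half-duration [h], a triple of distances carries all the data. *)
Lemma bad_triples_cover c : 0 < c -> exists B : set (R * R * R), [/\ measurable B,
  forall (a : 'I_3 -> R) (h : 'I_3 -> R) d c', d != 0 ->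
    (forall j, [/\ 0 <= h j, Gam (a j) (h j) = c%:E & Gam (a j - d) (h j) = c'%:E]) ->
    B (a (inord 0), a (inord 1), a (inord 2)) &
  forall a1 a2, a1 != a2 -> countable [set a3 | B (a1, a2, a3)]].
Proof.
move=> c0; have [A A0 GA] := level_radius al0 s0 c0.
have [H [HP Ha He]] := level_graph al0 s0 A0 GA.
pose U := [set` `](- A), A[].
have UE a : U a <-> `|a| < A by rewrite /U/= in_itv/= ltr_norml.
(* The value [0] outside [U] is the right height at [|a| = A], where the level curve ends. *)
pose hc : R -> R := H \_ U.
have mhc : measurable_fun [set: R] hc.
  apply: (measurable_restrictT H _).1; first exact: measurable_itv.
  have oU : open U by exact: interval_open.
  apply: (open_continuous_measurable_fun oU).
  by move=> a; rewrite inE => /UE aA; exact: analytic_at_continuous (Ha a aA).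
have hcP a : `|a| <= A -> [/\ 0 <= hc a, regular a (hc a) & G a (hc a) = c].
  rewrite le_eqVlt => /orP[/eqP aA|aA].
    rewrite /hc patchE memNset; last by move=> /UE; rewrite aA ltxx.
    by split=> //; [left; rewrite -normr_gt0 aA|rewrite -(rate_int_normr al s) aA].
  have [h0 reg Gc] := HP a aA.
  by rewrite /hc patchE mem_set; [split=> //; exact: ltW|exact/UE].
have hc_uniq a h : 0 <= h -> Gam a h = c%:E -> `|a| <= A /\ hc a = h.
  move=> h0 /(erate_int_fin_regular al0 s0 h0)[reg Gc].
  have aA : `|a| <= A.
    have [h00|hn0] := eqVneq h 0.
      by rewrite (level_boundary al0 s0 A0 GA _ _)// -?h00.
    by apply/ltW/(level_inside al0 s0 A0 GA _ reg Gc); rewrite lt_neqAle eq_sym hn0.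
  split=> //; have [h1 reg1 G1] := hcP a aA.
  by apply: (rate_int_injr al0 s0 reg1 reg); rewrite ?G1.
(* [g q a] is the inverse of the threshold that a sensor at distance [a] would assign to the
   trajectory translated by [q]; consistency means that the three values agree. *)
pose g (q a : R) := psi (a - q) (hc a).
have mg q : measurable_fun [set: R] (g q).
  have m1 : measurable_fun [set: R] (fun a => (a - q, hc a)).
    by apply: measurable_fun_pair => //; apply: measurable_funB => //; exact: measurable_cst.
  exact: (measurableT_comp measurable_psi m1).
have cg a : `|a| <= A -> continuous (g^~ a).
  by move=> /hcP[h0 _ _]; exact: psi_continuous.
pose D := [set a : R | `|a| <= A].
pose near2 (n : nat) (q : R) := [set z : R * R * R |
  `|g q z.1.1 - g q z.1.2| < n.+1%:R^-1 /\ `|g q z.1.1 - g q z.2| < n.+1%:R^-1].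
pose window (k : nat) (q : R) := (k.+1%:R^-1 < `|q| < k.+1%:R).
pose B := [set z : R * R * R | [/\ D z.1.1, D z.1.2 & D z.2]] `&`
  \bigcup_k \bigcap_n \bigcup_(q in [set q : rat | window k (ratr q)]) near2 n (ratr q).
have m11 : measurable_fun [set: R * R * R] (fun z => z.1.1).
  exact: (measurableT_comp measurable_fst measurable_fst).
have m12 : measurable_fun [set: R * R * R] (fun z => z.1.2).
  exact: (measurableT_comp measurable_snd measurable_fst).
have m2 : measurable_fun [set: R * R * R] (fun z => z.2) by exact: measurable_snd.
have mD : measurable D.
  rewrite (_ : D = [set` `[- A, A]]); first exact: measurable_itv.
  by apply/seteqP; split=> a; rewrite /D/= in_itv/= ler_norml.
have mpre (f : R * R * R -> R) (E : set R) : measurable_fun [set: R * R * R] f -> measurable E ->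
    measurable [set z | E (f z)].
  by move=> mf mE; rewrite -[X in measurable X]setTI; exact: mf.
have mlt (f : R * R * R -> R) (v : R) : measurable_fun [set: R * R * R] f ->
    measurable [set z | `|f z| < v].
  move=> mf; apply: (@mpre (fun z => `|f z|) [set` `]-oo, v[]) => //.
  by apply: measurableT_comp => //; exact: normr_measurable.
(* As psi is continuous, rational translations are enough to detect a common value up to 1 / (n + 1)
   for all n; an exact one is recovered by compactness of {k.+1^-1 <= |d| <= k.+1}. *)
exists B; split.
- apply: measurableI.
    rewrite (_ : [set z | _] = [set z : R * R * R | D z.1.1] `&` [set z | D z.1.2] `&` [set z | D z.2]).
      by apply: measurableI; [apply: measurableI|]; exact: mpre.
    by apply/seteqP; split=> z /=; [move=> [? ? ?]; split|move=> [[? ?] ?]; split].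
  apply: bigcupT_measurable => k; apply: bigcapT_measurable => n.
  rewrite bigcup_mkcond; apply: bigcupT_measurable_rat => q; case: ifP => // _.
  rewrite /near2; apply: measurableI.
    by apply: mlt; apply: measurable_funB; exact: (measurableT_comp (mg _)).
  by apply: mlt; apply: measurable_funB; exact: (measurableT_comp (mg _)).
- move=> a h d c' d0 ah.
  have hcE j : `|a j| <= A /\ hc (a j) = h j by have [h0 Gc _] := ah j; exact: hc_uniq.
  have gE j : g d (a j) = c'^-1.
    have [h0 _ Gc'] := ah j; have [_ E] := hcE j.
    by rewrite /g /psi E; have [_ ->] := erate_int_fin_regular al0 s0 h0 Gc'.
  have close (i j : 'I_3) n : exists2 e, 0 < e & forall q, `|q - d| < e ->
      `|g q (a i) - g q (a j)| < n.+1%:R^-1.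
    have cF : {for d, continuous (fun q => g q (a i) - g q (a j))}.
      by apply: cvgB; apply: cg; exact: (hcE _).1.
    have n0 : 0 < n.+1%:R^-1 :> R by rewrite invr_gt0 ltr0n.
    have [e /= e0 Hq] := (cvgrPdist_lt _ _).1 cF _ n0; exists e => // q qd.
    by have := Hq q; rewrite /ball_/= distrC !gE subrr sub0r normrN; apply.
  have nd : 0 < `|d| by rewrite normr_gt0.
  split=> /=; first by split; exact: (hcE _).1.
  pose k := maxn (Num.trunc `|d|) (Num.trunc `|d|^-1).
  have k1 : `|d| < k.+1%:R.
    by rewrite (lt_le_trans (truncnS_gt _))// ler_nat ltnS leq_maxl.
  have k2 : k.+1%:R^-1 < `|d|.
    rewrite -[ltRHS]invrK ltf_pV2 ?posrE ?invr_gt0 ?ltr0n//.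
    by rewrite (lt_le_trans (truncnS_gt _))// ler_nat ltnS leq_maxr.
  exists k => // n _.
  have [e1 e10 He1] := close (inord 0) (inord 1) n.
  have [e2 e20 He2] := close (inord 0) (inord 2) n.
  pose e := Num.min (Num.min e1 e2) (Num.min (k.+1%:R - `|d|) (`|d| - k.+1%:R^-1)).
  have e0 : 0 < e by rewrite !lt_min e10 e20 !subr_gt0 k1 k2.
  have [q /= /itvP qd] : exists q : rat, ratr q \in `]d, (d + e)[.
    by apply: rat_in_itvoo; rewrite ltrDl.
  have qe : `|ratr q - d| < e by rewrite ger0_norm ?subr_ge0 ?qd// ltrBlDl qd.
  move: (qe); rewrite !lt_min => /andP[/andP[qe1 qe2] /andP[qe3 qe4]].
  exists q; last by split; [exact: He1|exact: He2].
  have := ler_dist_dist (ratr q : R) d; rewrite ler_norml /window/=; move: qe3 qe4.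
  move: (k.+1%:R^-1 : R) => u; move: (k.+1%:R : R) => v ? ? /andP[? ?].
  by apply/andP; split; lra.
move=> a1 a2 a12.
pose C := [set d | [/\ regular (a1 - d) (hc a1), regular (a2 - d) (hc a2) &
                        G (a1 - d) (hc a1) = G (a2 - d) (hc a2)]].
pose S d := [set a | exists h, [/\ 0 <= h, regular a h, regular (a - d) h,
    G a h = c & G (a - d) h = G (a1 - d) (hc a1)]].
have [[/hcP[h10 _ _] /hcP[h20 _ _]]|nD] := pselect (D a1 /\ D a2); last first.
  rewrite (_ : [set a3 | _] = set0) ?countable0// predeqE => a3; split=> // -[/= [? ? _] _].
  by apply: nD.
have cC : countable C by exact: countable_transversal.
apply: (@sub_countable _ _ _ (\bigcup_(d in C `&` [set d | d != 0]) S d)); last first.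
  apply: bigcup_countable.
    by apply: sub_countable cC; apply: subset_card_le => x [].
  move=> d [[reg1 _ _] d0]; apply: countable_level => //; exact: rate_int_gt0.
apply: subset_card_le => a3 [/= [D1 D2 D3] [k _ Hk]].
have [h30 reg3 Gc3] := hcP _ D3.
have [d d0 [E12 E13]] : exists2 d, d != 0 & g d a1 = g d a2 /\ g d a1 = g d a3.
  pose w (q : R) := `|g q a1 - g q a2| + `|g q a1 - g q a3|.
  have cw : continuous w.
    move=> q; apply: cvgD; apply: cvg_norm; apply: cvgB; exact: cg.
  have w0 q : 0 <= w q by rewrite addr_ge0.
  have wE q : w q = 0 -> g q a1 = g q a2 /\ g q a1 = g q a3.
    move=> /eqP; rewrite paddr_eq0// !normr_eq0 !subr_eq0 => /andP[/eqP ? /eqP ?]; by split.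
  have k0 : 0 < k.+1%:R^-1 :> R by rewrite invr_gt0 ltr0n.
  have kk : k.+1%:R^-1 <= k.+1%:R :> R.
    by rewrite (@le_trans _ _ 1) ?invf_le1 ?ltr0n ?ler1n.
  have kk' : - k.+1%:R <= - k.+1%:R^-1 :> R by rewrite lerN2.
  have [p + Hp] := @EVT_min R w _ _ kk (continuous_subspaceT cw).
  have [m + Hm] := @EVT_min R w _ _ kk' (continuous_subspaceT cw).
  rewrite !in_itv/= => /andP[_ mk] /andP[kp _].
  have [wp|wp] := eqVneq (w p) 0.
    by exists p; [rewrite gt_eqF// (lt_le_trans k0)|exact: wE].
  have [wm|wm] := eqVneq (w m) 0.
    by exists m; [rewrite lt_eqF// (le_lt_trans mk)// oppr_lt0|exact: wE].
  have e0 : 0 < Num.min (w p) (w m) / 2 by rewrite divr_gt0// lt_min !lt_def wp wm !w0.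
  have [n _ Hn] := near_infty_natSinv_lt (PosNum e0).
  have [q /= /andP[kq qk] [q1 q2]] := Hk n I.
  have wq : w (ratr q) < Num.min (w p) (w m).
    have /= nw : n.+1%:R^-1 < Num.min (w p) (w m) / 2 := Hn n (leqnn _).
    move: (n.+1%:R^-1 : R) nw q1 q2 => v nw q1 q2.
    by rewrite /w; move: (Num.min _ _) nw => u nw; lra.
  have [q0|q0] := leP 0 (ratr q : R).
    move: kq qk; rewrite ger0_norm// => kq qk.
    have /Hp : (ratr q : R) \in `[k.+1%:R^-1, k.+1%:R] by rewrite in_itv/= !ltW.
    by move: wq; rewrite lt_min => /andP[? _] ?; lra.
  move: kq qk; rewrite ltr0_norm// => kq qk.
  have /Hm : (ratr q : R) \in `[- k.+1%:R, - k.+1%:R^-1].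
    by rewrite in_itv/= lerNl lerNr !ltW.
  by move: wq; rewrite lt_min => /andP[_ ?] ?; lra.
(* A common value [0] of [g] would make both points irregular, hence [a1 = d = a2]. *)
have reg1 : regular (a1 - d) (hc a1).
  have [//|nreg] := pselect (regular (a1 - d) (hc a1)).
  have a1d : a1 - d = 0 by apply/eqP; apply: contra_notT nreg => ?; left.
  have g0 : g d a2 = 0 by rewrite -E12 /g psi_irregular.
  case: (psi_eq0 h20 g0); left; apply: contra_neq a12 => a2d.
  by rewrite -[a1](subrK d) -[a2](subrK d) a1d a2d.
have g10 : g d a1 != 0 by apply/eqP => /(psi_eq0 h10).
have reg2 : regular (a2 - d) (hc a2).
  by have [//|/(psi_irregular h20) E] := pselect (regular (a2 - d) (hc a2));
    rewrite E12 /g E eqxx in g10.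
have reg3' : regular (a3 - d) (hc a3).
  by have [//|/(psi_irregular h30) E] := pselect (regular (a3 - d) (hc a3));
    rewrite E13 /g E eqxx in g10.
exists d; first by split=> //; split=> //; exact: invr_inj.
by exists (hc a3); split=> //; apply: invr_inj; exact/esym.
Qed.

End ExceptionalTriples.

(** * Null events *)

Section IndependentNull.
Context {R : realType} {d : measure_display} {Omega : measurableType d}.
Variable P : probability Omega R.
Local Open Scope ereal_scope.

Lemma independent_product_law d1 d2 (T1 : measurableType d1) (T2 : measurableType d2)
    (U : {mfun Omega >-> T1}) (V : {mfun Omega >-> T2}) :
  (forall A B, measurable A -> measurable B ->
    P ((U @^-1` A) `&` (V @^-1` B)) = P (U @^-1` A) * P (V @^-1` B)) ->
  forall N, measurable N ->
    (distribution P U \x distribution P V) N = P ((fun w => (U w, V w)) @^-1` N).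
Proof.
move=> ind N mN.
have mUV : measurable_fun setT (fun w => (U w, V w)) by exact: measurable_fun_pair.
pose UV : {mfun Omega >-> (T1 * T2)%type} :=
  HB.pack (fun w => (U w, V w)) (isMeasurableFun.Build _ _ _ _ _ mUV).
apply: (@product_measure_unique _ _ T1 T2 R (distribution P U) (distribution P V)
  (pushforward P UV)); last exact: mN.
by move=> A B mA mB; exact: ind.
Qed.

(** Under independence the joint law is the product law, which integrates the measures of the
    sections of [N]. *)
Lemma independent_null d1 d2 (T1 : measurableType d1) (T2 : measurableType d2)
    (U : {mfun Omega >-> T1}) (V : {mfun Omega >-> T2}) N :
  (forall A B, measurable A -> measurable B ->
    P ((U @^-1` A) `&` (V @^-1` B)) = P (U @^-1` A) * P (V @^-1` B)) ->
  measurable N -> (forall u, P (V @^-1` xsection N u) = 0) ->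
  P ((fun w => (U w, V w)) @^-1` N) = 0.
Proof.
move=> ind mN N0; rewrite -(independent_product_law ind mN).
by apply: integral0_eq => u _; exact: N0.
Qed.

Lemma independent_pair d1 (T : measurableType d1) (Z0 Z1 Z2 : {mfun Omega >-> T}) :
  (forall A B C, measurable A -> measurable B -> measurable C ->
    P ((Z0 @^-1` A) `&` (Z1 @^-1` B) `&` (Z2 @^-1` C)) =
    P (Z0 @^-1` A) * P (Z1 @^-1` B) * P (Z2 @^-1` C)) ->
  (forall A B, measurable A -> measurable B ->
    P ((Z0 @^-1` A) `&` (Z1 @^-1` B)) = P (Z0 @^-1` A) * P (Z1 @^-1` B)) /\
  (forall A C, measurable A -> measurable C ->
    P (((fun w => (Z0 w, Z1 w)) @^-1` A) `&` (Z2 @^-1` C)) =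
    P ((fun w => (Z0 w, Z1 w)) @^-1` A) * P (Z2 @^-1` C)).
Proof.
move=> ind.
have ind2 A B : measurable A -> measurable B ->
    P ((Z0 @^-1` A) `&` (Z1 @^-1` B)) = P (Z0 @^-1` A) * P (Z1 @^-1` B).
  move=> mA mB; have := ind A B setT mA mB measurableT.
  by rewrite preimage_setT setIT probability_setT mule1.
split=> // A C mA mC.
have mZC : measurable (Z2 @^-1` C) by rewrite -[X in measurable X]setTI; exact: measurable_funP.
have mW : measurable_fun setT (fun w => (Z0 w, Z1 w)) by exact: measurable_fun_pair.
have mWA : measurable ((fun w => (Z0 w, Z1 w)) @^-1` A).
  by rewrite -[X in measurable X]setTI; exact: mW.
(* If [C] has probability [0], both sides vanish. Otherwise the law of [(Z0, Z1)] conditioned on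
   [Z2] being in [C] agrees with the product law on rectangles, hence on all measurable sets. *)
have [C0|C0] := eqVneq (P (Z2 @^-1` C)) 0.
  rewrite C0 mule0; apply/eqP; rewrite eq_le measure_ge0 andbT -C0.
  by apply: le_measure; rewrite ?inE//; exact: measurableI.
have Cfin : P (Z2 @^-1` C) \is a fin_num by exact: fin_num_measure.
pose b := fine (P (Z2 @^-1` C)).
have bE : P (Z2 @^-1` C) = b%:E by rewrite fineK.
have b0 : (0 < b)%R by rewrite fine_gt0// lt_neqAle eq_sym C0 measure_ge0 ltey_eq Cfin.
have bi0 : (0 <= b^-1)%R by rewrite invr_ge0 ltW.
pose W : {mfun Omega >-> (T * T)%type} :=
  HB.pack (fun w => (Z0 w, Z1 w)) (isMeasurableFun.Build _ _ _ _ _ mW).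
pose M : {measure set (T * T)%type -> \bar R} := ltac:(
  pose M := (pushforward (mrestr P mZC) W : {measure set (T * T)%type -> \bar R}); exact: (M mW)).
pose m' := mscale (NngNum bi0) M.
have m'E X : m' X = (b^-1)%:E * P (((fun w => (Z0 w, Z1 w)) @^-1` X) `&` (Z2 @^-1` C)) by [].
have E : (distribution P Z0 \x distribution P Z1) A = m' A.
  apply: (@product_measure_unique _ _ T T R (distribution P Z0) (distribution P Z1) m') => // A0 B0 mA0 mB0.
  transitivity ((b^-1)%:E * P ((Z0 @^-1` A0) `&` (Z1 @^-1` B0) `&` (Z2 @^-1` C))).
    exact: (m'E (A0 `*` B0)).
  by rewrite ind// bE muleC -muleA -EFinM divff ?mule1// gt_eqF.
have := independent_product_law ind2 mA; rewrite E => <-.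
by rewrite m'E bE muleC muleA -EFinM divff ?mul1e// gt_eqF.
Qed.

End IndependentNull.

(** * Lines carry no mass *)

Section Lines.
Context {R : realType}.

Definition line (n1 n2 k : R) : set (R * R) := [set q | n1 * q.1 + n2 * q.2 = k].

Lemma measurable_line (n1 n2 k : R) : measurable (line n1 n2 k).
Proof.
have mf : measurable_fun [set: R * R] (fun q => n1 * q.1 + n2 * q.2).
  apply: measurable_funD; apply: measurable_funM => //.
have := mf measurableT [set k] (measurable_set1 k).
by rewrite setTI.
Qed.

Lemma lebesgue2_line (n1 n2 k : R) : n1 != 0 \/ n2 != 0 ->
  ((@lebesgue_measure R) \x (@lebesgue_measure R))%E (line n1 n2 k) = 0%E.
Proof.
have [n20|n20] := eqVneq n2 0 => n0.
  have {n0} n10 : n1 != 0 by case: n0.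
  rewrite (_ : line n1 n2 k = [set k / n1] `*` setT).
    rewrite product_measure1E//.
    by rewrite [X in (X * _)%E]lebesgue_measure_set1 mul0e.
  apply/seteqP; split=> -[x y]; rewrite /line/= n20 mul0r addr0.
    by move=> <-; split=> //; rewrite mulrAC divff ?mul1r.
  by move=> [-> _]; rewrite mulrC divfK.
apply: integral0_eq => x _ /=.
rewrite (_ : xsection _ _ = [set (k - n1 * x) / n2]) ?lebesgue_measure_set1//.
apply/seteqP; split=> y; rewrite /xsection/= inE /line/=.
  by move=> <-; rewrite addrAC subrr add0r mulrAC divff ?mul1r.
by move=> ->; rewrite [n2 * _]mulrC divfK// addrC subrK.
Qed.

End Lines.

Section CountableLines.
Context {R : realType} {d : measure_display} {Omega : measurableType d}.
Variables (P : probability Omega R) (Z : {mfun Omega >-> (R * R)%type}).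
Hypothesis Z_line : forall n1 n2 k, n1 != 0 \/ n2 != 0 -> P (Z @^-1` line n1 n2 k) = 0%E.

Lemma measurable_preimage_line n1 n2 k : measurable (Z @^-1` line n1 n2 k).
Proof. by rewrite -[X in measurable X]setTI; apply: measurable_funP => //; exact: measurable_line. Qed.

Lemma negligible_line n1 n2 k : n1 != 0 \/ n2 != 0 -> P.-negligible (Z @^-1` line n1 n2 k).
Proof. by move=> n0; apply/negligibleP; [exact: measurable_preimage_line|exact: Z_line]. Qed.

(** The fibres of the linear form are lines, so its law has no atoms. *)
Lemma negligible_countable_lines n1 n2 (C : set R) : n1 != 0 \/ n2 != 0 -> countable C ->
  P.-negligible (Z @^-1` [set q | C (n1 * q.1 + n2 * q.2)]).
Proof.
move=> n0 /countable_injP[f finj].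
apply: (@negligibleS _ _ _ _ (\bigcup_i (Z @^-1` [set q | exists2 k, C k /\ f k = i & line n1 n2 k q]))).
  by move=> w /= Cw; exists (f (n1 * (Z w).1 + n2 * (Z w).2)) => //=; eexists; split=> //.
apply: negligible_bigcup => i.
have [[k [Ck fk]]|/forallNP noC] := pselect (exists k, C k /\ f k = i).
  apply: (negligibleS _ (negligible_line k n0)) => w /= [k' [Ck' fk'] H].
  by rewrite (_ : k = k')//; apply: finj; rewrite ?inE// fk fk'.
apply: (negligibleS _ (negligible_set0 P)) => w /= [k' Ck' _].
exact: (noC k').
Qed.

End CountableLines.

Lemma independent3 (R : realType) (d : measure_display) (Omega : measurableType d)
    (P : probability Omega R) (Z : 'I_3 -> Omega -> R * R) (A B C : set (R * R)) :
  mutually_independent3 P Z -> measurable A -> measurable B -> measurable C ->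
  P ((Z (inord 0) @^-1` A) `&` (Z (inord 1) @^-1` B) `&` (Z (inord 2) @^-1` C)) =
  (P (Z (inord 0) @^-1` A) * P (Z (inord 1) @^-1` B) * P (Z (inord 2) @^-1` C))%E.
Proof.
move=> ind mA mB mC; pose F (j : 'I_3) := match val j with 0%N => A | 1%N => B | _ => C end.
have mF j : measurable (F j) by rewrite /F; case: (val j) => [//|[|]].
have F0 : F (inord 0) = A by rewrite /F/= inordK.
have F1 : F (inord 1) = B by rewrite /F/= inordK.
have F2 : F (inord 2) = C by rewrite /F/= inordK.
have := ind F mF; rewrite !big_ord_recl big_ord0 mule1 muleA.
have -> : ord0 = inord 0 :> 'I_3 by apply: val_inj; rewrite /= inordK.
have -> : lift (inord 0) ord0 = inord 1 :> 'I_3 by apply: val_inj; rewrite /= !inordK.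
have -> : lift (inord 0) (lift ord0 ord0) = inord 2 :> 'I_3 by apply: val_inj; rewrite /= !inordK.
rewrite F0 F1 F2 => <-; congr (P _); apply/seteqP; split=> w /=.
  move=> [[wA wB] wC] j _; have jE k : (k < 3)%N -> val j = k -> j = inord k.
    by move=> k3 jk; apply: val_inj; rewrite /= inordK.
  have := ltn_ord j; case E : (val j) => [|[|[|//]]] _.
  - by rewrite (jE 0%N)// F0.
  - by rewrite (jE 1%N)// F1.
  - by rewrite (jE 2%N)// F2.
by move=> H; split; [split|]; rewrite -?F0 -?F1 -?F2; exact: H.
Qed.

Lemma in_rangeE (R : realType) (al lamb lamT lams xo yo th s t0 : R) (q : R * R) : 0 < s ->
  in_range al lamb lamT lams xo yo th s t0 q =
  [set t | (((lamT - lamb) / lams)%:E <= erate_int al s ((q.1 - xo) * cos th - (q.2 - yo) * sin th)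
    (t - (t0 + ((q.1 - xo) * sin th + (q.2 - yo) * cos th) / s)))%E].
Proof. by move=> s0; apply/funext => t; rewrite /in_range/= window_intE. Qed.

(** Twice the signed area of the triangle, zero exactly for collinear points. *)
Definition det3 (R : realType) (q1 q2 q3 : R * R) : R :=
  (q2.1 - q1.1) * (q3.2 - q1.2) - (q3.1 - q1.1) * (q2.2 - q1.2).

Section ExceptionalConfigurations.
Context {R : realType} {d : measure_display} {Omega : measurableType d}.
Variables (P : probability Omega R) (Z0 Z1 Z2 : {mfun Omega >-> (R * R)%type}).
Hypothesis Z1_line : forall n1 n2 k, n1 != 0 \/ n2 != 0 -> P (Z1 @^-1` line n1 n2 k) = 0%E.
Hypothesis Z2_line : forall n1 n2 k, n1 != 0 \/ n2 != 0 -> P (Z2 @^-1` line n1 n2 k) = 0%E.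
Hypothesis ind : forall A B C, measurable A -> measurable B -> measurable C ->
  P ((Z0 @^-1` A) `&` (Z1 @^-1` B) `&` (Z2 @^-1` C)) =
  (P (Z0 @^-1` A) * P (Z1 @^-1` B) * P (Z2 @^-1` C))%E.

(** [independent_null] is applied to [Z1] given [Z0], then to [Z2] given a pair with distinct values
    of [l]. Such a pair has [q1 <> q2], so the third points collinear with it form a line, and [B]
    confines [l] of the third point to a countable set. *)
Lemma exceptional_negligible (n1 n2 l0 : R) (B : set (R * R * R)) :
  n1 != 0 \/ n2 != 0 -> measurable B ->
  (forall a1 a2, a1 != a2 -> countable [set a3 | B (a1, a2, a3)]) ->
  let l (q : R * R) := n1 * q.1 + n2 * q.2 - l0 in
  {ae P, forall w, [/\ l (Z0 w) != l (Z1 w), det3 (Z0 w) (Z1 w) (Z2 w) != 0 &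
    ~ B (l (Z0 w), l (Z1 w), l (Z2 w))]}.
Proof.
move=> n0 mB Bcount l.
have ml : measurable_fun [set: R * R] l.
  by apply: measurable_funB => //; apply: measurable_funD; apply: measurable_funM.
have fibre_line (a : R) : [set q | l q = a] = line n1 n2 (a + l0).
  by apply/seteqP; split=> q; rewrite /line/= /l; [move=> <-; ring|move=> ->; ring].
have [ind01 ind012] := independent_pair ind.
have mW : measurable_fun [set: Omega] (fun w => (Z0 w, Z1 w)) by exact: measurable_fun_pair.
pose W : {mfun Omega >-> (R * R * (R * R))%type} :=
  HB.pack (fun w => (Z0 w, Z1 w)) (isMeasurableFun.Build _ _ _ _ _ mW).
pose N1 := [set z : (R * R) * (R * R) | l z.1 = l z.2].
have mN1 : measurable N1.
  rewrite -[N1]setTI (_ : N1 = (fun z => l z.1 - l z.2) @^-1` [set 0]); last first.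
    by apply/seteqP; split=> z; rewrite /N1/=; [move=> ->; rewrite subrr|move/eqP; rewrite subr_eq0 => /eqP].
  have m : measurable_fun [set: (R * R) * (R * R)] (fun z => l z.1 - l z.2).
    by apply: measurable_funB; [exact: (measurableT_comp ml measurable_fst)
      |exact: (measurableT_comp ml measurable_snd)].
  by apply: m => //; exact: measurable_set1.
have N10 : P ((fun w => (Z0 w, Z1 w)) @^-1` N1) = 0%E.
  apply: independent_null => // q.
  rewrite (_ : xsection N1 q = line n1 n2 (l q + l0)); first exact: Z1_line.
  by rewrite -fibre_line; apply/seteqP; split=> u; rewrite /xsection/= inE /N1/=.
(* Excluding [N1] here makes every section null, as [independent_null] requires, and not only almost
   every one. *)
pose N2 := [set z : ((R * R) * (R * R)) * (R * R) | ~ N1 z.1 /\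
  (det3 z.1.1 z.1.2 z.2 = 0 \/ B (l z.1.1, l z.1.2, l z.2))].
have mN2 : measurable N2.
  have m11 : measurable_fun [set: ((R * R) * (R * R)) * (R * R)] (fun z => z.1.1).
    exact: (measurableT_comp measurable_fst measurable_fst).
  have m12 : measurable_fun [set: ((R * R) * (R * R)) * (R * R)] (fun z => z.1.2).
    exact: (measurableT_comp measurable_snd measurable_fst).
  have m2 : measurable_fun [set: ((R * R) * (R * R)) * (R * R)] (fun z => z.2).
    exact: measurable_snd.
  have mfst := @measurable_fst _ _ R R; have msnd := @measurable_snd _ _ R R.
  have mdet : measurable_fun [set: ((R * R) * (R * R)) * (R * R)]
      (fun z => det3 z.1.1 z.1.2 z.2).
    apply: measurable_funB; apply: measurable_funM; apply: measurable_funB;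
      by [exact: (measurableT_comp mfst m11)|exact: (measurableT_comp mfst m12)
         |exact: (measurableT_comp mfst m2)|exact: (measurableT_comp msnd m11)
         |exact: (measurableT_comp msnd m12)|exact: (measurableT_comp msnd m2)].
  have mlll : measurable_fun [set: ((R * R) * (R * R)) * (R * R)]
      (fun z => (l z.1.1, l z.1.2, l z.2)).
    by apply: measurable_fun_pair; first apply: measurable_fun_pair; exact: measurableT_comp.
  rewrite (_ : N2 = (fst @^-1` (~` N1)) `&`
    (((fun z => det3 z.1.1 z.1.2 z.2) @^-1` [set 0]) `|`
     ((fun z => (l z.1.1, l z.1.2, l z.2)) @^-1` B)))//.
  apply: measurableI; last apply: measurableU.
  - by rewrite -[X in measurable X]setTI; apply: measurable_fst => //; exact: measurableC.
  - by rewrite -[X in measurable X]setTI; apply: mdet => //; exact: measurable_set1.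
  - by rewrite -[X in measurable X]setTI; apply: mlll.
have N20 : P ((fun w => (W w, Z2 w)) @^-1` N2) = 0%E.
  apply: (independent_null (U := W) (V := Z2)) => // -[q1 q2].
  have mS : measurable (Z2 @^-1` xsection N2 (q1, q2)).
    rewrite -[X in measurable X]setTI; apply: (measurable_funP (Z2)) => //.
    exact: measurable_xsection.
  apply: (measure_negligible mS).
  have [eql|neql] := pselect (l q1 = l q2).
    apply: (negligibleS _ (negligible_set0 P)) => w /=.
    by rewrite /xsection/= inE => -[].
  apply: (@negligibleS _ _ _ _ ((Z2 @^-1` line (- (q2.2 - q1.2)) (q2.1 - q1.1)
      ((q2.1 - q1.1) * q1.2 - (q2.2 - q1.2) * q1.1)) `|`
    (Z2 @^-1` [set q | [set a | B (l q1, l q2, a - l0)] (n1 * q.1 + n2 * q.2)]))).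
    move=> w; rewrite /= /xsection/= inE => -[_ [E|E]]; [left|right] => /=.
      by move: E; rewrite /det3 /line/= => E; apply/eqP; rewrite -subr_eq0; apply/eqP; rewrite -[RHS]E; ring.
    exact: E.
  apply: negligibleU.
    apply: (negligible_line Z2_line).
    have [dy|dy] := eqVneq (q2.2 - q1.2) 0; last by left; rewrite oppr_eq0.
    right; apply/eqP => dx; apply: neql.
    by rewrite /l -(subrK q1.1 q2.1) -(subrK q1.2 q2.2) dx dy !add0r.
  apply: (negligible_countable_lines Z2_line) => //.
  have /Bcount cB : l q1 != l q2 by exact/eqP.
  rewrite (_ : [set a | _] = (fun a => a + l0) @` [set a3 | B (l q1, l q2, a3)]).
    exact: sub_countable (card_image_le _ _) cB.
  apply/seteqP; split=> a /=; first by exists (a - l0); rewrite ?subrK.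
  by move=> [u Bu <-]; rewrite addrK.
have negN : P.-negligible (((fun w => (Z0 w, Z1 w)) @^-1` N1) `|`
                           ((fun w => (W w, Z2 w)) @^-1` N2)).
  apply: negligibleU; apply/negligibleP => //.
    by rewrite -[X in measurable X]setTI; exact: (mW measurableT _ mN1).
  rewrite -[X in measurable X]setTI.
  have mWZ : measurable_fun [set: Omega] (fun w => (W w, Z2 w)) by exact: measurable_fun_pair.
  exact: (mWZ measurableT _ mN2).
apply: (negligibleS _ negN) => w /=; apply: contra_notP => /not_orP[nN1 nN2].
split; first exact/eqP.
  by apply/eqP => E; apply: nN2; split=> //; left.
by move=> Bw; apply: nN2; split=> //; right.
Qed.

End ExceptionalConfigurations.

Theorem theorem1 (R : realType) (d : measure_display) (Omega : measurableType d)
  (P : probability Omega R) (X Y : 'I_3 -> Omega -> R)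
  (alpha lamb lamT t0 : R) :
  (* random, i.i.d., absolutely continuous sensor locations with zero mean *)
  (forall j, measurable_fun setT (X j)) ->
  (forall j, measurable_fun setT (Y j)) ->
  mutually_independent3 P (fun j w => (X j w, Y j w)) ->
  identically_distributed3 P (fun j w => (X j w, Y j w)) ->
  abs_cont_lebesgue2 P (fun w => (X ord0 w, Y ord0 w)) ->
  (forall j, P.-integrable setT (EFin \o X j) /\ ('E_P[X j] = 0)%E) ->
  (forall j, P.-integrable setT (EFin \o Y j) /\ ('E_P[Y j] = 0)%E) ->
  (* model constants *)
  0 <= alpha -> 0 <= lamb -> lamb < lamT ->
  (* true (unknown) parameters *)
  forall (xo yo th s lams : R),
    0 <= th < 2 * pi -> 0 < s -> 0 < lams ->
  {ae P, forall w : Omega,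
    forall t1 t2 : 'I_3 -> R,
      (* the source triggers the three sensors, with noise-free time stamps *)
      (forall j, time_stamps alpha lamb lamT lams xo yo th s t0
                   (X j w, Y j w) (t1 j) (t2 j)) ->
      (* standing assumption: unimodal noise-free photon counts *)
      (forall j, unimodal (photon_count alpha lamb lams xo yo th s t0 (X j w, Y j w))) ->
      (* any linear trajectory, with any intensity, consistent with the data
         coincides with the true one *)
      forall (xo' yo' th' s' lams' : R),
        0 <= th' < 2 * pi -> 0 < s' -> 0 < lams' ->
        (forall j, time_stamps alpha lamb lamT lams' xo' yo' th' s' t0
                     (X j w, Y j w) (t1 j) (t2 j)) ->
        [/\ th' = th, s' = s, xo' = xo & yo' = yo]}.
Proof.
move=> mX mY ind iden ac _ _ al0 _ lamTb xo yo th s lams th2 s0 lams0.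
have mZ j : measurable_fun [set: Omega] (fun w => (X j w, Y j w)) by exact: measurable_fun_pair.
pose Z j : {mfun Omega >-> (R * R)%type} :=
  HB.pack (fun w => (X j w, Y j w)) (isMeasurableFun.Build _ _ _ _ _ (mZ j)).
have Z_line j (n1 n2 k : R) : n1 != 0 \/ n2 != 0 -> P (Z j @^-1` line n1 n2 k) = 0%E.
  move=> n0; rewrite (iden j (line n1 n2 k) (measurable_line _ _ _)).
  by apply: ac; [exact: measurable_line|exact: lebesgue2_line].
have dir0 : cos th != 0 \/ - sin th != 0.
  have [c0|] := eqVneq (cos th) 0; last by left.
  right; rewrite oppr_eq0; apply/eqP => sn0.
  by have /eqP := cos2Dsin2 th; rewrite c0 sn0 expr0n/= addr0 eq_sym oner_eq0.
pose l (q : R * R) := (q.1 - xo) * cos th - (q.2 - yo) * sin th.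
pose l0 := xo * cos th - yo * sin th.
have lE q : l q = (cos th * q.1 + - sin th * q.2) - l0 by rewrite /l /l0; ring.
have c0 : 0 < (lamT - lamb) / lams by rewrite divr_gt0// subr_gt0.
(* [B] depends only on [alpha], the true speed and the true normalised threshold: the exceptional
   event is fixed before the competing trajectory and intensity are chosen. *)
have [B [mB Bbad Bcount]] := bad_triples_cover al0 s0 c0.
pose i0 : 'I_3 := inord 0; pose i1 : 'I_3 := inord 1; pose i2 : 'I_3 := inord 2.
have := exceptional_negligible (Z0 := Z i0) (Z_line i1) (Z_line i2)
  (fun A B C => @independent3 _ _ _ P _ A B C ind) l0 dir0 mB Bcount.
apply: filterS => w [_ ndet nB].
move=> t1 t2 ts _ xo' yo' th' s' lams' th'2 s'0 lams'0 ts'.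
have lev j : [/\ t1 j + t2 j = 2 * (t0 + ((X j w - xo) * sin th + (Y j w - yo) * cos th) / s),
    0 <= (t2 j - t1 j) / 2 &
    erate_int alpha s (l (X j w, Y j w)) ((t2 j - t1 j) / 2) = ((lamT - lamb) / lams)%:E].
  by have := ts j; rewrite /time_stamps in_rangeE// => -[]; exact: time_stamps_level.
have lev' j : [/\ t1 j + t2 j = 2 * (t0 + ((X j w - xo') * sin th' + (Y j w - yo') * cos th') / s'),
    0 <= (t2 j - t1 j) / 2 &
    erate_int alpha s' ((X j w - xo') * cos th' - (Y j w - yo') * sin th') ((t2 j - t1 j) / 2)
      = ((lamT - lamb) / lams')%:E].
  by have := ts' j; rewrite /time_stamps in_rangeE// => -[]; exact: time_stamps_level.
have [E1 E2 along] : [/\ th' = th, s' = s & (xo' - xo) * sin th + (yo' - yo) * cos th = 0].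
  apply: (@trajectory_unique _ (X^~ w) (Y^~ w) t0 xo yo th s xo' yo' th' s' i0 i1 i2 ndet) => // j.
  have [m1 _ _] := lev j; have [m2 _ _] := lev' j.
  by apply: (@mulfI _ 2) => //; rewrite -m1 -m2.
pose dl := (xo' - xo) * cos th - (yo' - yo) * sin th.
have [dl0|dl0] := eqVneq dl 0.
  have [dx dy] := rotation_kernel dl0 along.
  by split=> //; apply/eqP; rewrite -subr_eq0; apply/eqP.
(* The competing trajectory has signed distances [l - dl] and normalised threshold
   [(lamT - lamb) / lams'], which puts the triple in [B]. *)
exfalso; apply: nB; rewrite -!lE.
apply: (Bbad (fun j => l (X j w, Y j w)) (fun j => (t2 j - t1 j) / 2) dl ((lamT - lamb) / lams')) => // j.
have [_ h0 Gc] := lev j; have [_ _ Gc'] := lev' j; split=> //.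
by rewrite -Gc' E1 E2 (_ : l _ - dl = (X j w - xo') * cos th - (Y j w - yo') * sin th)// /l /dl/=; ring.
Qed.
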